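(* Let $R=B[x;\sigma,\delta]_p$ be a Poisson-Cauchon extension with associated torus $\mathcal H$. If $B$ is a noetherian $\mathcal H$-Poisson-UFD, then so is $R$.
   Context: $\mathbb K$ is a field of characteristic $0$; algebras are $\mathbb K$-algebras, derivations are $\mathbb K$-linear. A Poisson algebra is a commutative algebra with a Lie bracket $\{-,-\}$ that is a derivation in each variable; a Poisson domain is a Poisson algebra that is an integral domain; a Poisson ideal is an ideal $I$ with $\{R,I\}\subseteq I$. A Poisson action of a group is an action by algebra automorphisms preserving the bracket. A Poisson derivation $\sigma$ of $B$ is a derivation for both product and bracket; a Poisson $\sigma$-derivation is a derivation $\delta$ for the product with $\delta(\{a,b\})=\{\delta(a),b\}+\{a,\delta(b)\}+\sigma(a)\delta(b)-\delta(a)\sigma(b)$. The Poisson-Ore extension $B[x;\sigma,\delta]_p$ is the polynomial algebra $B[x]$ with the unique Poisson bracket extending that of $B$ and satisfying $\{x,b\}=\sigma(b)x+\delta(b)$. For a rational action of a torus $\mathcal H\cong(\mathbb K^* )^r$ on an algebra, $\mathrm{Lie}\,\mathcal H\cong\mathbb K^r$ acts by the differential: if $a$ is an $\mathcal H$-eigenvector with eigenvalue $h\mapsto h_1^{u_1}\cdots h_r^{u_r}$, then $\xi\cdot a=(u_1\xi_1+\dots+u_r\xi_r)a$. A Poisson-Cauchon extension of a Poisson algebra $B$ is a Poisson-Ore extension $R=B[x;\sigma,\delta]_p$ equipped with a rational Poisson action of a torus $\mathcal H$ such that (i) $B$ is $\mathcal H$-stable and $x$ is an $\mathcal H$-eigenvector;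 (ii) $\delta$ is locally nilpotent; (iii) there is $h_\circ\in\mathrm{Lie}\,\mathcal H$ such that $\sigma=(h_\circ\cdot)|_B$ and the $h_\circ$-eigenvalue $\lambda_\circ$ of $x$ is nonzero. A Poisson-prime element of a Poisson domain $R$ is a nonzero $c$ with $\{c,R\}\subseteq Rc$ and $R/(c)$ a domain. Given a Poisson action of a group $\mathcal H$ on $R$, an $\mathcal H$-Poisson-prime ideal is a proper $\mathcal H$-stable Poisson ideal $P$ such that $IJ\subseteq P$ implies $I\subseteq P$ or $J\subseteq P$ for all $\mathcal H$-stable Poisson ideals $I,J$. A Poisson domain $R$ with Poisson $\mathcal H$-action is an $\mathcal H$-Poisson-UFD if each nonzero $\mathcal H$-Poisson-prime ideal of $R$ contains a Poisson-prime $\mathcal H$-eigenvector. ($B$ carries the restricted $\mathcal H$-action.) *)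

(* Defs.v *)
From HB Require Import structures.
From mathcomp Require Import all_boot all_algebra.
From mathcomp Require Import classical_sets.

Set Implicit Arguments.
Unset Strict Implicit.
Unset Printing Implicit Defensive.

Import GRing.Theory.
Local Open Scope ring_scope.
Local Open Scope classical_set_scope.

(* [{poly B}] is a [B]-algebra in the library; the alias [polyalg B] carries
   the structure of algebra over the base field [K] of [B]. *)
Definition polyalg (K : fieldType) (B : comAlgType K) : Type := {poly B}.

Section PolyAlg.
Variables (K : fieldType) (B : comAlgType K).

HB.instance Definition _ := GRing.ComNzRing.copy (polyalg B) {poly B}.

Definition polyalg_scale (c : K) (p : polyalg B) : polyalg B :=
  (c%:A : B) *: (p : {poly B}).

Fact polyalg_scaleA c d p :
  polyalg_scale c (polyalg_scale d p) = polyalg_scale (c * d) p.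
Proof. by rewrite /polyalg_scale scalerA -scalerAl mul1r scalerA. Qed.

Fact polyalg_scale1 : left_id 1 polyalg_scale.
Proof. by move=> p; rewrite /polyalg_scale !scale1r. Qed.

Fact polyalg_scaleDr : right_distributive polyalg_scale +%R.
Proof. by move=> c p q; rewrite /polyalg_scale scalerDr. Qed.

Fact polyalg_scaleDl p : {morph polyalg_scale^~ p : c d / c + d}.
Proof. by move=> c d; rewrite /polyalg_scale !scalerDl. Qed.

HB.instance Definition _ := GRing.Zmodule_isLmodule.Build K (polyalg B)
  polyalg_scaleA polyalg_scale1 polyalg_scaleDr polyalg_scaleDl.

Fact polyalg_scaleAl (c : K) (p q : polyalg B) : c *: (p * q) = c *: p * q.
Proof. exact: (@scalerAl B {poly B} c%:A p q). Qed.

HB.instance Definition _ :=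
  GRing.Lmodule_isLalgebra.Build K (polyalg B) polyalg_scaleAl.
HB.instance Definition _ := GRing.Lalgebra_isComAlgebra.Build K (polyalg B).

End PolyAlg.

Section PoissonAlgebra.
Variables (K : fieldType) (A : comAlgType K).
Implicit Types (br : A -> A -> A) (I J P : set A).

Definition derivation (d : A -> A) : Prop :=
  linear d /\ forall a b, d (a * b) = d a * b + a * d b.

Record poisson_bracket br : Prop := PoissonBracket {
  pbr_derl : forall b, derivation (br^~ b);
  pbr_derr : forall a, derivation (br a);
  pbr_alt : forall a, br a a = 0;
  pbr_jacobi : forall a b c,
    br a (br b c) + br b (br c a) + br c (br a b) = 0
}.

Definition poisson_derivation br (sigma : A -> A) : Prop :=
  derivation sigma /\
  forall a b, sigma (br a b) = br (sigma a) b + br a (sigma b).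

Definition poisson_skew_derivation br (sigma delta : A -> A) : Prop :=
  derivation delta /\
  forall a b, delta (br a b)
    = br (delta a) b + br a (delta b) + sigma a * delta b - delta a * sigma b.

Definition locally_nilpotent (d : A -> A) : Prop :=
  forall a, exists n, iter n d a = 0.

Record ideal I : Prop := Ideal {
  ideal0 : I 0;
  idealD : forall a b, I a -> I b -> I (a + b);
  idealMl : forall a b, I b -> I (a * b)
}.

Definition noetherian : Prop :=
  forall I_ : nat -> set A,
    (forall n, ideal (I_ n)) -> (forall n, I_ n `<=` I_ n.+1) ->
    exists N, forall n, (N <= n)%N -> I_ n = I_ N.

Definition principal_ideal (c : A) : set A := [set a * c | a in setT].

Definition ideal_product I J : set A :=
  [set x | exists s : seq (A * A),
     (forall p, p \in s -> I p.1 /\ J p.2) /\ x = \sum_(p <- s) p.1 * p.2].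

(* [A/I] is an integral domain, spelled out on representatives. *)
Definition quotient_domain I : Prop :=
  ~ I 1 /\ forall a b, I (a * b) -> I a \/ I b.

Definition poisson_ideal br I : Prop :=
  ideal I /\ forall a b, I b -> I (br a b).

Definition poisson_prime_element br (c : A) : Prop :=
  [/\ c != 0,
      forall a, principal_ideal c (br c a)
    & quotient_domain (principal_ideal c)].

End PoissonAlgebra.

Section GroupAction.
Variables (K : fieldType) (A : comAlgType K) (G : groupType).
Implicit Types (br : A -> A -> A) (act : G -> A -> A) (I J P : set A).

Record poisson_action br act : Prop := PoissonAction {
  pact1 : forall a, act 1%g a = a;
  pactM : forall g h a, act (g * h)%g a = act g (act h a);
  pact_linear : forall g, linear (act g);
  pact_mul : forall g a b, act g (a * b) = act g a * act g b;
  pact_one : forall g, act g 1 = 1;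
  pact_br : forall g a b, act g (br a b) = br (act g a) (act g b)
}.

Definition eigenvector act (a : A) : Prop :=
  a != 0 /\ exists chi : G -> K, forall g, act g a = chi g *: a.

Definition stable act I : Prop := forall g a, I a -> I (act g a).

Definition stable_poisson_ideal br act I : Prop :=
  poisson_ideal br I /\ stable act I.

Definition equiv_poisson_prime br act P : Prop :=
  [/\ stable_poisson_ideal br act P,
      P <> setT
    & forall I J, stable_poisson_ideal br act I ->
        stable_poisson_ideal br act J ->
        ideal_product I J `<=` P -> I `<=` P \/ J `<=` P].

Record equiv_poisson_ufd br act : Prop := EquivPoissonUFD {
  epufd_domain : GRing.integral_domain_axiom A;
  epufd_bracket : poisson_bracket br;
  epufd_action : poisson_action br act;
  epufd_prime : forall P, equiv_poisson_prime br act P -> P <> [set 0] ->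
    exists c, [/\ P c, poisson_prime_element br c & eigenvector act c]
}.

End GroupAction.

Section UnitsGroup.
Variable K : fieldType.

Record nzscalar : Type := NzScalar { nzval :> K; nzvalP : nzval != 0 }.

HB.instance Definition _ := [isSub for nzval].
HB.instance Definition _ := [Choice of nzscalar by <:].

Definition nz1 : nzscalar := NzScalar (oner_neq0 K).

Definition nzmul (x y : nzscalar) : nzscalar :=
  NzScalar (mulf_neq0 (nzvalP x) (nzvalP y)).

Fact nzinv_proof (x : nzscalar) : (x : K)^-1 != 0.
Proof. by rewrite invr_neq0 ?nzvalP. Qed.

Definition nzinv (x : nzscalar) : nzscalar := NzScalar (nzinv_proof x).

Fact nzmulA : associative nzmul.
Proof. by move=> x y z; apply/val_inj/mulrA. Qed.

Fact nzmul1 : left_id nz1 nzmul.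
Proof. by move=> x; apply/val_inj/mul1r. Qed.

Fact nzmulr1 : right_id nz1 nzmul.
Proof. by move=> x; apply/val_inj/mulr1. Qed.

Fact nzmulV : left_inverse nz1 nzinv nzmul.
Proof. by move=> x; apply/val_inj/mulVf/nzvalP. Qed.

Fact nzmulrV : right_inverse nz1 nzinv nzmul.
Proof. by move=> x; apply/val_inj/divff/nzvalP. Qed.

HB.instance Definition _ := isGroup.Build nzscalar
  nzmulA nzmul1 nzmulr1 nzmulV nzmulrV.

End UnitsGroup.

(* The group law is the pointwise one of the library. *)
Definition torus (K : fieldType) (r : nat) : groupType :=
  {ffun 'I_r -> nzscalar K}.

Section TorusAction.
Variables (K : fieldType) (r : nat).

Definition monomial_char (u : 'rV[int]_r) (h : torus K r) : K :=
  \prod_(i < r) (h i : K) ^ u 0 i.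

(* The regular functions on a torus are the Laurent polynomials. *)
Definition regular_function (f : torus K r -> K) : Prop :=
  exists (m : nat) (c : 'I_m -> K) (u : 'I_m -> 'rV[int]_r),
    forall h, f h = \sum_(k < m) c k * monomial_char (u k) h.

Variable A : comAlgType K.
Implicit Type act : torus K r -> A -> A.

(* Every element lies in a finite-dimensional stable subspace, with basis [v],
   on which the torus acts through a morphism of algebraic groups. *)
Definition rational_action act : Prop :=
  forall a, exists (n : nat) (v : 'I_n -> A) (M : torus K r -> 'M[K]_n),
    [/\ forall c : 'I_n -> K, \sum_(i < n) c i *: v i = 0 -> forall i, c i = 0,
        exists c : 'I_n -> K, a = \sum_(i < n) c i *: v i,
        forall h j, act h (v j) = \sum_(i < n) M h i j *: v i
      & forall i j, regular_function (fun h => M h i j)].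

(* [D] is the action of [xi] in [Lie H = K^r].  For a rational action the
   eigenvectors span [A], so these conditions determine [D]. *)
Definition lie_action act (xi : 'rV[K]_r) (D : A -> A) : Prop :=
  linear D /\
  forall (u : 'rV[int]_r) a,
    (forall h, act h a = monomial_char u h *: a) ->
    D a = (\sum_(i < r) (u 0 i)%:~R * xi 0 i) *: a.

End TorusAction.

Section PoissonOre.
Variables (K : fieldType) (B : comAlgType K).
Variables (br : B -> B -> B) (sigma delta : B -> B).
Variable brR : polyalg B -> polyalg B -> polyalg B.

(* [(polyalg B, brR)] is [B[x; sigma, delta]_p]. *)
Record poisson_ore : Prop := PoissonOre {
  pore_base : poisson_bracket br;
  pore_sigma : poisson_derivation br sigma;
  pore_delta : poisson_skew_derivation br sigma delta;
  pore_bracket : poisson_bracket brR;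
  pore_ext : forall a b : B, brR a%:P b%:P = (br a b)%:P;
  pore_X : forall b : B, brR 'X b%:P = (sigma b)%:P * 'X + (delta b)%:P
}.

Variables (r : nat) (act : torus K r -> polyalg B -> polyalg B).

Definition base_subalgebra : set (polyalg B) := [set b%:P | b in @setT B].

Record poisson_cauchon : Prop := PoissonCauchon {
  pc_ore : poisson_ore;
  pc_action : poisson_action brR act;
  pc_rational : rational_action act;
  pc_stable : stable act base_subalgebra;
  pc_eigen : eigenvector act 'X;
  pc_nilpotent : locally_nilpotent delta;
  pc_lie : exists (h0 : 'rV[K]_r) (D : polyalg B -> polyalg B),
    [/\ lie_action act h0 D,
        forall b : B, D b%:P = (sigma b)%:P
      & exists2 lambda : K, lambda != 0 & D 'X = lambda *: ('X : polyalg B)]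
}.

(* When [B] is stable, [act h b%:P] is a constant polynomial, and its constant
   coefficient is the image of [b] under the restricted action. *)
Definition restricted_action (h : torus K r) (b : B) : B :=
  (act h b%:P : {poly B})`_0.

End PoissonOre.

(* Main.v *)
Require Import Defs.
From mathcomp Require Import all_boot all_order all_algebra.
From mathcomp Require Import boolp classical_sets.
From mathcomp Require Import zify ring.

Set Implicit Arguments.
Unset Strict Implicit.
Unset Printing Implicit Defensive.

Import Order.TTheory GRing.Theory Num.Theory.
Local Open Scope ring_scope.

(** Why the theorem holds. In the localization [R[X^-1]] the operator
    [D - X^-1 {X, -}], where [D] is the infinitesimal torus action that extends
    [sigma], is a derivation of the product and of the bracket. The local
    nilpotency of [delta] makes it diagonalizable, with eigenvalues [n lambda],
    and its kernel is a copy of [B], the image of the Cauchon map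
    [b |-> sum_j (-lambda)^-j / j! delta^j(b) X^-j]. So [R[X^-1]] is graded, with
    [X] of degree one and a copy of [B] in degree zero, and the torus respects
    the grading. Everything is done inside [R], with the eigenvectors that are
    polynomials: [homogeneous n f] is the eigenvector equation multiplied by
    [X]. An element of weight [n] is determined by its coefficient at [X ^ n]
    ([homogeneous_inj]), which may be any [b] with [delta ^ (n + 1) b = 0]
    ([homogeneous_lift]); products and brackets add weights, and the bracket is
    seen on leading coefficients by [pcoef_bracket_top].

    A Poisson-prime eigenvector [u] of [B] is lifted to the [q] of least weight
    with leading coefficient [u]. Its constant coefficient is nonzero, so the
    prime element [X] does not divide [q], and divisibility by [q] may be tested
    after inverting [X], where [q] generates the ideal of the copy of [u]. Hence
    [q] is a Poisson-prime eigenvector of [R] ([lift_prime_eigenvector]).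

    It remains to find such a [q] in a nonzero equivariant Poisson prime [P] of
    [R]. By [equiv_prime_radical], which uses that [R] is noetherian
    ([hilbert_basis]), [P] is a radical ideal, so either [X] is regular modulo
    [P] or [X \in P] ([equiv_prime_eigenvector]).
    - If [X] is regular modulo [P], a Vandermonde argument shows that [P] is
      graded ([saturated_graded]), so that it is governed by the ideal of the
      leading coefficients of its homogeneous elements. This is a nonzero
      equivariant Poisson prime of [B]; a Poisson-prime eigenvector in it lifts
      into [P].
    - If [X \in P] and [delta = 0], then [X] itself is a Poisson-prime
      eigenvector. If [X \in P] and [delta <> 0], then [{X, b} \in P] puts
      [delta b] into [P], so that the contraction of [P] to [B] is a nonzero
      equivariant Poisson prime, and it contains some [u]. Modulo [X] the lift
      [q] is a multiple of [delta ^ s u], so it lies in [P].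

    The infinitesimal action is only known on weight vectors. That these span
    ([weight_decomposition]) follows from the independence of characters, and
    yields that [D] preserves the stable subspaces ([lie_stable]). *)

(** * Linear subspaces and separation of eigenvalues *)

Section Subspaces.
Variables (K : fieldType) (A : comAlgType K).
Implicit Types (S I : set A).

Definition subspace S : Prop :=
  S 0 /\ forall (c : K) a b, S a -> S b -> S (c *: a + b).

Lemma subspaceZ S c a : subspace S -> S a -> S (c *: a).
Proof. by case=> S0 SP Sa; rewrite -[_ *: _]addr0; apply: SP. Qed.

Lemma subspaceD S a b : subspace S -> S a -> S b -> S (a + b).
Proof. by case=> S0 SP Sa Sb; rewrite -[a]scale1r; apply: SP. Qed.

Lemma subspace_sum S (T : Type) (s : seq T) (P : pred T) (F : T -> A) :
  subspace S -> (forall t, P t -> S (F t)) -> S (\sum_(t <- s | P t) F t).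
Proof.
move=> sS SF; apply: (big_ind S) => //; first by case: sS.
by move=> a b; apply: subspaceD.
Qed.

Lemma subspace_sum_seq S (T : eqType) (s : seq T) (F : T -> A) :
  subspace S -> (forall t, t \in s -> S (F t)) -> S (\sum_(t <- s) F t).
Proof. by move=> sS SF; rewrite big_seq; apply: subspace_sum. Qed.

Lemma linear_at0 (d : A -> A) : linear d -> d 0 = 0.
Proof.
move=> lin; have := lin 1 0 0; rewrite !scale1r addr0 => /esym e.
by apply: (addrI (d 0)); rewrite addr0.
Qed.

Lemma derivation_at1 (d : A -> A) : derivation d -> d 1 = 0.
Proof.
case=> _ /(_ 1 1); rewrite !mulr1 mul1r => /esym e.
by apply: (addrI (d 1)); rewrite addr0.
Qed.

Lemma idealZ I (c : K) a : ideal I -> I a -> I (c *: a).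
Proof. by move=> hI Ia; rewrite -mulr_algl; apply: idealMl. Qed.

Lemma idealN I a : ideal I -> I a -> I (- a).
Proof. by move=> hI Ia; rewrite -mulN1r; apply: idealMl. Qed.

Lemma ideal_mulr I a b : ideal I -> I a -> I (a * b).
Proof. by move=> hI Ia; rewrite mulrC; apply: idealMl. Qed.

Lemma idealB I a b : ideal I -> I a -> I b -> I (a - b).
Proof. by move=> hI Ia Ib; apply: idealD => //; apply: idealN. Qed.

Lemma idealZr I (c : K) a : ideal I -> c != 0 -> I (c *: a) -> I a.
Proof.
by move=> hI c0 /(idealZ c^-1 hI); rewrite scalerA mulVf // scale1r.
Qed.

Lemma ideal_subspace I : ideal I -> subspace I.
Proof.
move=> hI; split; first exact: ideal0.
by move=> c a b Ia Ib; apply: idealD => //; apply: idealZ.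
Qed.

Lemma principal_ideal_ideal (c : A) : ideal (principal_ideal c).
Proof.
split; first by exists 0; rewrite ?mul0r.
- by move=> _ _ [a _ <-] [b _ <-]; exists (a + b); rewrite ?mulrDl.
- by move=> a _ [b _ <-]; exists (a * b); rewrite ?mulrA.
Qed.

End Subspaces.

(** Lagrange interpolation on the joint spectrum: the product over [l] of the
    factors [(ev g - ev g k) / (ev g k0 - ev g k)], with [g] depending on [k], is
    an indicator. This is the common core of the linear independence of
    characters and of the Vandermonde argument; [C] will say that the
    combination of the components with the coefficients [a] lies in some
    subspace. *)
Lemma separating_weights (K : fieldType) (G : Type) (T : eqType)
    (ev : G -> T -> K) (C : (T -> K) -> Prop) (k0 : T) (l : seq T) :
  (forall k, (forall g, ev g k = ev g k0) -> k = k0) ->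
  C (fun=> 1) ->
  (forall c d a b, C a -> C b -> C (fun k => c * a k + d * b k)) ->
  (forall g a, C a -> C (fun k => ev g k * a k)) ->
  exists2 a, C a & forall k, k \in k0 :: l -> a k = (k == k0)%:R.
Proof.
move=> sep C1 CD Cev; elim: l => [|k l [a Ca aE]].
  by exists (fun=> 1) => // k; rewrite inE => /eqP ->; rewrite eqxx.
have [->|kk0] := eqVneq k k0.
  by exists a => // k'; rewrite !inE orbA orbb -in_cons; apply: aE.
have [g gk] : exists g, ev g k != ev g k0.
  apply: contrapT => H; move/eqP: kk0; apply; apply: sep => g.
  by apply/eqP; apply: contrapT => /negP H'; apply: H; exists g.
have d0 : ev g k0 - ev g k != 0 by rewrite subr_eq0 eq_sym.
pose c := (ev g k0 - ev g k)^-1.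
exists (fun k' => c * (ev g k' * a k') + (- (c * ev g k)) * a k').
  exact: (CD _ _ _ _ (Cev g _ Ca) Ca).
move=> k'; rewrite !inE => /or3P[/eqP->|/eqP->|k'l].
- by rewrite aE ?inE ?eqxx // !mulr1 -mulrBr mulVf.
- by rewrite mulrA -mulrDl subrr mul0r (negPf kk0).
- rewrite aE ?inE ?k'l ?orbT //; case: eqP => [->|_]; last by rewrite !mulr0 addr0.
  by rewrite !mulr1 -mulrBr mulVf.
Qed.

(** * Poisson brackets *)

Section PoissonBrackets.
Variables (K : fieldType) (A : comAlgType K) (br : A -> A -> A).
Hypothesis brP : poisson_bracket br.
Implicit Types (a b c : A).

Lemma pbrDl a b c : br (a + b) c = br a c + br b c.
Proof. by have [/(_ 1 a b)] := pbr_derl brP c; rewrite !scale1r. Qed.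

Lemma pbrDr a b c : br c (a + b) = br c a + br c b.
Proof. by have [/(_ 1 a b)] := pbr_derr brP c; rewrite !scale1r. Qed.

Lemma pbr0l c : br 0 c = 0.
Proof. by apply: (addrI (br 0 c)); rewrite -pbrDl !addr0. Qed.

Lemma pbr0r c : br c 0 = 0.
Proof. by apply: (addrI (br c 0)); rewrite -pbrDr !addr0. Qed.

Lemma pbrZl k a c : br (k *: a) c = k *: br a c.
Proof. by have [/(_ k a 0)] := pbr_derl brP c; rewrite pbr0l !addr0. Qed.

Lemma pbrZr k a c : br c (k *: a) = k *: br c a.
Proof. by have [/(_ k a 0)] := pbr_derr brP c; rewrite pbr0r !addr0. Qed.

Lemma pbrMl a b c : br (a * b) c = br a c * b + a * br b c.
Proof. by have [_] := pbr_derl brP c. Qed.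

Lemma pbrMr a b c : br c (a * b) = br c a * b + a * br c b.
Proof. by have [_] := pbr_derr brP c. Qed.

Lemma pbrC a b : br a b = - br b a.
Proof.
apply/eqP; rewrite -addr_eq0; apply/eqP.
by have := pbr_alt brP (a + b); rewrite pbrDl !pbrDr !(pbr_alt brP) add0r addr0.
Qed.

Lemma pbrNl a c : br (- a) c = - br a c.
Proof. by rewrite -scaleN1r pbrZl scaleN1r. Qed.

Lemma pbrNr a c : br c (- a) = - br c a.
Proof. by rewrite -scaleN1r pbrZr scaleN1r. Qed.

Lemma pbr_leibniz a b c : br a (br b c) = br (br a b) c + br b (br a c).
Proof.
have := pbr_jacobi brP a b c; rewrite (pbrC c (br a b)) (pbrC c a) pbrNr.
by move=> H; apply/eqP; rewrite -subr_eq0 -[X in _ == X]H; apply/eqP; ring.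
Qed.

Lemma pbrX n a c : br c (a ^+ n) = n%:R * a ^+ n.-1 * br c a.
Proof.
elim: n => [|n IH].
  rewrite expr0 !mul0r; apply: (addrI (br c 1)).
  by rewrite -{1}(mulr1 (br c 1)) -{2}(mul1r (br c 1)) -pbrMr mulr1 addr0.
rewrite exprS pbrMr IH /= -natr1; case: n {IH} => [|n] /=.
  by rewrite expr0; ring.
by rewrite exprS; ring.
Qed.

Lemma poisson_ideal_bracket (I : set A) a b :
  poisson_ideal br I -> I a -> I (br a b).
Proof. by case=> hI sI Ia; rewrite pbrC; apply: idealN => //; apply: sI. Qed.

End PoissonBrackets.

Section PoissonActions.
Variables (K : fieldType) (A : comAlgType K) (G : groupType).
Variables (br : A -> A -> A) (act : G -> A -> A).
Hypothesis actP : poisson_action br act.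

Lemma actD g a b : act g (a + b) = act g a + act g b.
Proof. by have := pact_linear actP g 1 a b; rewrite !scale1r. Qed.

Lemma act0 g : act g 0 = 0.
Proof. by apply: (addrI (act g 0)); rewrite -actD !addr0. Qed.

Lemma actZ g c a : act g (c *: a) = c *: act g a.
Proof. by have := pact_linear actP g c a 0; rewrite act0 !addr0. Qed.

Lemma act_sum g (T : Type) (s : seq T) (P : pred T) (F : T -> A) :
  act g (\sum_(t <- s | P t) F t) = \sum_(t <- s | P t) act g (F t).
Proof. exact: (big_morph (act g) (actD g) (act0 g)). Qed.

Lemma actX g a n : act g (a ^+ n) = act g a ^+ n.
Proof.
by elim: n => [|n IH]; rewrite ?(pact_one actP) // !exprS (pact_mul actP) IH.
Qed.

Lemma eigenvalue_neq0 x (chi : G -> K) :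
  x != 0 -> (forall g, act g x = chi g *: x) -> forall g, chi g != 0.
Proof.
move=> x0 xE g; apply/eqP => c0; move/eqP: x0; apply.
by rewrite -[x](pact1 actP) -(mulVg g) (pactM actP) xE c0 scale0r act0.
Qed.

End PoissonActions.

(** * Rational torus actions and their differentials *)

Section Characters.
Variables (K : fieldType) (r : nat).
Implicit Types (u v : 'rV[int]_r) (h g : torus K r).

Lemma monomial_charM u h g :
  monomial_char u (h * g)%g = monomial_char u h * monomial_char u g.
Proof.
rewrite /monomial_char -big_split /=; apply: eq_bigr => i _.
by rewrite ffunE -expfzMl.
Qed.

Lemma monomial_char1 u : monomial_char u (1%g : torus K r) = 1.
Proof. by rewrite /monomial_char big1 // => i _; rewrite ffunE /= exp1rz. Qed.

Lemma monomial_charD u v h :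
  monomial_char (u + v) h = monomial_char u h * monomial_char v h.
Proof.
rewrite /monomial_char -big_split /=; apply: eq_bigr => i _.
by rewrite mxE expfzDr // nzvalP.
Qed.

Hypothesis charK0 : [pchar K] =i pred0.

Lemma pchar0_natf_neq0 (n : nat) : (n%:R == 0 :> K) = (n == 0)%N.
Proof. by move: n; apply/pcharf0P. Qed.

Lemma pchar0_natf_inj (m n : nat) : m%:R = n%:R :> K -> m = n.
Proof.
wlog le : m n / (n <= m)%N => [H e|].
  by case: (leqP n m) => [|/ltnW] le; [exact: H | apply/esym/H].
move/eqP; rewrite -subr_eq0 -natrB // pchar0_natf_neq0 subn_eq0 => ge.
by apply/eqP; rewrite eqn_leq le ge.
Qed.

Lemma two_neq0 : (2%:R : K) != 0.
Proof. by rewrite pchar0_natf_neq0. Qed.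

Lemma expz2_inj (m n : int) : (2%:R : K) ^ m = 2%:R ^ n -> m = n.
Proof.
wlog le_nm : m n / (n <= m)%R.
  move=> H; case: (lerP n m) => [|/ltW] le; first exact: H.
  by move=> e; apply/esym/H.
have t0 := two_neq0.
move=> e; have: (2%:R : K) ^ (m - n) = 1.
  by rewrite expfzDr // e -expfzDr // subrr.
have [p ->] : exists p : nat, m = n + p.
  exists (absz (m - n)); lia.
rewrite addrC addKr -exprnP -natrX => /eqP.
have p1 : (1 <= 2 ^ p)%N by rewrite expn_gt0.
rewrite -subr_eq0 -[X in _ - X](mulr1n 1) -natrB // pchar0_natf_neq0.
case: p p1 => [|p _ le]; first by rewrite addr0.
have := @ltn_expl 2 p.+1 isT; lia.
Qed.

(** In characteristic zero the integer [2] has infinite order, so evaluating at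
    the one-parameter point with a single coordinate [2] recovers exponents. *)
Lemma monomial_char_inj u v :
  (forall h, monomial_char u h = monomial_char v h) -> u = v.
Proof.
move=> e; apply/rowP => i; apply: expz2_inj.
pose h : torus K r := [ffun j => if j == i then NzScalar two_neq0 else nz1 K].
have E w : monomial_char w h = 2%:R ^ w 0 i.
  rewrite /monomial_char (bigD1 i) //= ffunE eqxx big1 ?mulr1 //.
  by move=> j /negPf ji; rewrite ffunE ji /= exp1rz.
by rewrite -!E.
Qed.

End Characters.

Section RationalActions.
Variables (K : fieldType) (charK0 : [pchar K] =i pred0).
Variables (A : comAlgType K) (r : nat) (act : torus K r -> A -> A).
Variable br : A -> A -> A.
Hypotheses (actP : poisson_action br act) (actR : rational_action act).

Definition weight_vector (u : 'rV[int]_r) (a : A) : Prop :=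
  forall h, act h a = monomial_char u h *: a.

Lemma sum_by_key (s : seq ('rV[int]_r * A)) (c : 'rV[int]_r -> K) :
  \sum_(t <- s) c t.1 *: t.2
  = \sum_(u <- undup [seq t.1 | t <- s]) c u *: \sum_(t <- s | t.1 == u) t.2.
Proof.
under [RHS]eq_bigr do rewrite scaler_sumr big_mkcond /=.
rewrite exchange_big /= big_seq [RHS]big_seq; apply: eq_bigr => t ts.
rewrite (bigD1_seq t.1) ?undup_uniq ?mem_undup ?map_f //=.
by rewrite eqxx big1 ?addr0 // => u; rewrite eq_sym => /negPf ->.
Qed.

(** Isotypic parts can be extracted by linear combinations as soon as the
    situation persists under multiplication by characters. The index [i] is
    trivial for a stable subspace and runs through the torus for the
    independence of characters. *)
Lemma isotypic_part (I : Type) (S : I -> set A) (s : seq ('rV[int]_r * A))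
    (F : I -> 'rV[int]_r * A -> A) (u : 'rV[int]_r) :
  (forall i, subspace (S i)) ->
  (forall i, S i (\sum_(t <- s) F i t)) ->
  (forall h c, (forall i, S i (\sum_(t <- s) c t.1 *: F i t)) ->
     forall i, S i (\sum_(t <- s) (monomial_char t.1 h * c t.1) *: F i t)) ->
  forall i, S i (\sum_(t <- s | t.1 == u) F i t).
Proof.
move=> sS S1 Sev i.
have [||||c Cc cE] := @separating_weights K (torus K r) _ (fun h v => monomial_char v h)
  (fun c => forall i, S i (\sum_(t <- s) c t.1 *: F i t)) u [seq t.1 | t <- s].
- by move=> v; apply: monomial_char_inj.
- by move=> j; under eq_bigr do rewrite scale1r.
- move=> c d a b Sa Sb j; under eq_bigr do rewrite scalerDl -!scalerA.
  rewrite big_split /= -!scaler_sumr.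
  by apply: subspaceD => //; apply: subspaceZ.
- exact: Sev.
rewrite big_mkcond /=; have := Cc i.
rewrite big_seq (eq_bigr (fun t => if t.1 == u then F i t else 0)) -?big_seq //.
by move=> t ts; rewrite cE ?inE ?map_f ?orbT //; case: eqP; rewrite ?scale1r ?scale0r.
Qed.

Definition regular_orbit (F : torus K r -> A) : Prop :=
  exists s : seq ('rV[int]_r * A),
    forall h, F h = \sum_(t <- s) monomial_char t.1 h *: t.2.

Lemma regular_orbit_sum (n : nat) (F : 'I_n -> torus K r -> A) :
  (forall i, regular_orbit (F i)) -> regular_orbit (fun h => \sum_(i < n) F i h).
Proof.
elim: n F => [|n IH] F RF; first by exists [::] => h; rewrite big_ord0 big_nil.
have [s sE] := RF ord_max.
have [s' s'E] := IH (fun i => F (widen_ord (leqnSn n) i)) (fun i => RF _).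
by exists (s' ++ s) => h; rewrite big_ord_recr big_cat /= -sE -s'E.
Qed.

Lemma rational_regular_orbit a : regular_orbit (act^~ a).
Proof.
have [n [v [M [_ [c ->] Mv Mreg]]]] := actR a.
have -> : act^~ (\sum_(i < n) c i *: v i)
    = fun h => \sum_(j < n) \sum_(i < n) M h i j *: (c j *: v i).
  apply/funext => h; rewrite (act_sum actP); apply: eq_bigr => j _.
  rewrite (actZ actP) Mv scaler_sumr; apply: eq_bigr => i _.
  by rewrite !scalerA mulrC.
apply: regular_orbit_sum => j; apply: regular_orbit_sum => i.
have [m [d [u E]]] := Mreg i j.
exists [seq (u k, d k *: (c j *: v i)) | k <- enum 'I_m] => h.
rewrite big_map big_enum E scaler_suml /=; apply: eq_bigr => k _.
by rewrite mulrC -scalerA.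
Qed.

(** A regular orbit map [h |-> sum_u u(h) a_u] is compared at [g h]: since
    characters are independent, [g] acts on [a_u] by the scalar [u(g)]. *)
Lemma weight_decomposition a :
  exists2 s : seq ('rV[int]_r * A),
    forall t, t \in s -> weight_vector t.1 t.2 & a = \sum_(t <- s) t.2.
Proof.
have [s sE] := rational_regular_orbit a.
exists [seq (u, \sum_(t <- s | t.1 == u) t.2) | u <- undup [seq t.1 | t <- s]].
  move=> _ /mapP[u _ ->] g /=.
  apply/eqP; rewrite -subr_eq0; apply/eqP.
  have H : forall h, \sum_(t <- s | t.1 == u)
      monomial_char t.1 h *: (act g t.2 - monomial_char t.1 g *: t.2) = 0.
    apply: (@isotypic_part (torus K r) (fun _ a => a = 0)).
    - by move=> _; split=> // c x y -> ->; rewrite scaler0 addr0.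
    - move=> h; under eq_bigr do
        rewrite scalerBr -(actZ actP) scalerA mulrC -monomial_charM.
      by rewrite sumrB -(act_sum actP) -!sE (pactM actP) subrr.
    - move=> k c H h; rewrite -[RHS](H (h * k)%g); apply: eq_bigr => t _.
      by rewrite !scalerA monomial_charM; congr (_ *: _); ring.
  rewrite (act_sum actP) scaler_sumr -sumrB -[RHS](H 1%g).
  by apply: eq_bigr => t /eqP ->; rewrite monomial_char1 scale1r.
rewrite big_map -[LHS](pact1 actP) sE.
rewrite (sum_by_key s (fun u => monomial_char u 1%g)).
by apply: eq_bigr => u _ /=; rewrite monomial_char1 scale1r.
Qed.

Section Differential.
Variables (xi : 'rV[K]_r) (D : A -> A).
Hypothesis lieD : lie_action act xi D.

Let D_lin c a b : D (c *: a + b) = c *: D a + D b.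
Proof. exact: (proj1 lieD). Qed.

Lemma lie0 : D 0 = 0.
Proof. exact: linear_at0 (proj1 lieD). Qed.

Lemma lie_add a b : D (a + b) = D a + D b.
Proof. by have := D_lin 1 a b; rewrite !scale1r. Qed.

Lemma lieZ c a : D (c *: a) = c *: D a.
Proof. by have := D_lin c a 0; rewrite lie0 !addr0. Qed.

Lemma lie_sum (T : Type) (s : seq T) (P : pred T) (F : T -> A) :
  D (\sum_(t <- s | P t) F t) = \sum_(t <- s | P t) D (F t).
Proof. exact: (big_morph D lie_add lie0). Qed.

Definition lie_weight (u : 'rV[int]_r) : K := \sum_(i < r) (u 0 i)%:~R * xi 0 i.

Lemma lie_weight_vector u a : weight_vector u a -> D a = lie_weight u *: a.
Proof. by case: lieD => _; apply. Qed.

Lemma lie_weightD u v : lie_weight (u + v) = lie_weight u + lie_weight v.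
Proof.
rewrite /lie_weight -big_split /=; apply: eq_bigr => i _.
by rewrite mxE rmorphD /= mulrDl.
Qed.

Lemma weight_vector_ind (P : A -> Prop) :
  P 0 -> (forall a b, P a -> P b -> P (a + b)) ->
  (forall u a, weight_vector u a -> P a) -> forall a, P a.
Proof.
move=> P0 PD Pw a; have [s sw ->] := weight_decomposition a.
elim: s sw => [|t s IH] sw; first by rewrite big_nil.
rewrite big_cons; apply: PD.
  by apply: (Pw t.1); apply: sw; rewrite mem_head.
by apply: IH => t' t's; apply: sw; rewrite inE t's orbT.
Qed.

Lemma lie_act h a : D (act h a) = act h (D a).
Proof.
move: a; apply: weight_vector_ind => [|a b ea eb|u a wa].
- by rewrite (act0 actP) lie0 (act0 actP).
- by rewrite (actD actP) !lie_add (actD actP) ea eb.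
- by rewrite wa lieZ (lie_weight_vector wa) (actZ actP) wa !scalerA mulrC.
Qed.

Lemma lie_mul a b : D (a * b) = D a * b + a * D b.
Proof.
move: a; apply: weight_vector_ind => [|a a' ea ea'|u a wa].
- by rewrite mul0r lie0 !mul0r addr0.
- by rewrite mulrDl !lie_add ea ea'; ring.
move: b; apply: weight_vector_ind => [|b b' eb eb'|v b wb].
- by rewrite mulr0 lie0 !mulr0 addr0.
- by rewrite mulrDr !lie_add eb eb'; ring.
have wab : weight_vector (u + v) (a * b).
  by move=> h; rewrite (pact_mul actP) wa wb -scalerAl -scalerAr scalerA -monomial_charD.
rewrite !(lie_weight_vector wab, lie_weight_vector wa, lie_weight_vector wb).
by rewrite lie_weightD scalerDl scalerAl scalerAr.
Qed.

(** A stable subspace contains the isotypic components of its elements, and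
    the differential only rescales these. *)
Lemma lie_stable (S : set A) a :
  subspace S -> stable act S -> S a -> S (D a).
Proof.
move=> sS stS; have [s sw aE] := weight_decomposition a => Sa.
have key u : S (\sum_(t <- s | t.1 == u) t.2).
  apply: (@isotypic_part unit (fun=> S) s (fun _ t => t.2) u) => //.
    by move=> _; rewrite -aE.
  move=> h c Sc _; have := stS h _ (Sc tt).
  rewrite (act_sum actP) big_seq [X in _ -> S X]big_seq.
  by under eq_bigr => t ts do rewrite (actZ actP) sw // scalerA mulrC.
have -> : D a = \sum_(t <- s) lie_weight t.1 *: t.2.
  rewrite aE lie_sum big_seq [RHS]big_seq; apply: eq_bigr => t ts.
  exact/lie_weight_vector/sw.
rewrite sum_by_key; apply: subspace_sum => // u _; exact: subspaceZ.
Qed.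

Lemma lie_bracket a b : poisson_bracket br ->
  D (br a b) = br (D a) b + br a (D b).
Proof.
move=> brP.
move: a; apply: weight_vector_ind => [|a a' ea ea'|u a wa].
- by rewrite (pbr0l brP) lie0 !(pbr0l brP) addr0.
- by rewrite !(pbrDl brP) !lie_add (pbrDl brP) ea ea'; ring.
move: b; apply: weight_vector_ind => [|b b' eb eb'|v b wb].
- by rewrite (pbr0r brP) lie0 !(pbr0r brP) addr0.
- by rewrite !(pbrDr brP) !lie_add (pbrDr brP) eb eb'; ring.
have wab : weight_vector (u + v) (br a b).
  move=> h; rewrite (pact_br actP) wa wb (pbrZl brP) (pbrZr brP).
  by rewrite scalerA -monomial_charD.
rewrite !(lie_weight_vector wab, lie_weight_vector wa, lie_weight_vector wb).
by rewrite lie_weightD scalerDl (pbrZl brP) (pbrZr brP).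
Qed.

End Differential.

End RationalActions.

(** * Coefficients of polynomials and the basis theorem *)

Section Coefficients.
Variables (K : fieldType) (B : comAlgType K).
Implicit Types (f g : polyalg B) (b : B) (k n m : nat).

(** Constants typed in [polyalg B], so that the sums and products built from
    them are those of the [K]-algebra. *)
Definition pX : polyalg B := 'X.
Definition pC b : polyalg B := b%:P.
Definition pcoef f k : B := (f : {poly B})`_k.

Lemma pcoefP f g : (forall k, pcoef f k = pcoef g k) -> f = g.
Proof. by move=> H; apply/(@polyP B). Qed.

Lemma pcoef0 k : pcoef 0 k = 0. Proof. exact: coef0. Qed.
Lemma pcoefD f g k : pcoef (f + g) k = pcoef f k + pcoef g k.
Proof. exact: coefD. Qed.
Lemma pcoefN f k : pcoef (- f) k = - pcoef f k.
Proof. exact: coefN. Qed.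
Lemma pcoefB f g k : pcoef (f - g) k = pcoef f k - pcoef g k.
Proof. exact: coefB. Qed.
Lemma pcoefZ (c : K) f k : pcoef (c *: f) k = c *: pcoef f k.
Proof.
rewrite -[RHS]mulr_algl; exact: (@coefZ B c%:A f k).
Qed.
Lemma pcoefC b k : pcoef (pC b) k = if k == 0%N then b else 0.
Proof. exact: coefC. Qed.
Lemma pcoefXM0 f : pcoef (pX * f) 0 = 0.
Proof. exact: (coefXM f 0). Qed.
Lemma pcoefXMS f k : pcoef (pX * f) k.+1 = pcoef f k.
Proof. exact: (coefXM f k.+1). Qed.
Lemma pcoefCM b f k : pcoef (pC b * f) k = b * pcoef f k.
Proof. exact: coefCM. Qed.
Lemma pcoefM0 f g : pcoef (f * g) 0 = pcoef f 0 * pcoef g 0.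
Proof. exact: coef0M. Qed.

Lemma pC0 : pC 0 = 0. Proof. exact: polyC0. Qed.
Lemma pC1 : pC 1 = 1. Proof. by []. Qed.
Lemma pCD a b : pC (a + b) = pC a + pC b. Proof. exact: polyCD. Qed.
Lemma pCM a b : pC (a * b) = pC a * pC b. Proof. exact: polyCM. Qed.

Lemma pCZ (c : K) b : pC (c *: b) = c *: pC b.
Proof. by apply: pcoefP => -[|k]; rewrite pcoefZ !pcoefC ?scaler0. Qed.

Lemma pcoefXnM m n f : pcoef (pX ^+ m * f) (m + n) = pcoef f n.
Proof. by elim: m => [|m IH]; rewrite ?mul1r // exprS -mulrA pcoefXMS. Qed.

Lemma pX_neq0 : pX != 0.
Proof. exact: (negbT (polyX_eq0 B)). Qed.

Lemma pX_inj f g : pX * f = pX * g -> f = g.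
Proof. by move=> e; apply: pcoefP => k; rewrite -!(pcoefXMS _ k) e. Qed.

Lemma pXn_inj n f g : pX ^+ n * f = pX ^+ n * g -> f = g.
Proof. by elim: n => [|n IH]; rewrite ?mul1r // exprS -!mulrA => /pX_inj. Qed.

Lemma pX_quotient f : exists g, f = pX * g + pC (pcoef f 0).
Proof.
exists (\poly_(i < (size (f : {poly B}))) (f : {poly B})`_i.+1).
apply: pcoefP => -[|k]; rewrite pcoefD pcoefC /= ?pcoefXM0 ?add0r // addr0.
rewrite pcoefXMS /pcoef coef_poly; case: ltnP => // le.
by rewrite nth_default // (leq_trans le).
Qed.

Lemma poly_ind_pX (P : polyalg B -> Prop) :
  P 0 -> (forall f b, P f -> P (pX * f + pC b)) -> forall f, P f.
Proof.
move=> P0 PS; apply: (@poly_ind B P) => // f b Pf.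
by have := PS f b Pf; rewrite mulrC.
Qed.

Definition degree_lt n f := forall k, (n <= k)%N -> pcoef f k = 0.

Lemma degree_lt_size f : degree_lt (size (f : {poly B})) f.
Proof. by move=> k; apply: nth_default. Qed.

Lemma degree_lt0 f : degree_lt 0 f -> f = 0.
Proof. by move=> d; apply: pcoefP => k; rewrite pcoef0 d. Qed.

Lemma degree_lt1 f : degree_lt 1 f -> f = pC (pcoef f 0).
Proof. by move=> d; apply: pcoefP => -[|k]; rewrite pcoefC //= d. Qed.

Lemma degree_ltXS n f : degree_lt n f -> degree_lt n.+1 (pX * f).
Proof. by move=> d [|k] //; rewrite ltnS pcoefXMS => /d. Qed.

Lemma pcoefM_top n m f g : degree_lt n.+1 f -> degree_lt m.+1 g ->
  forall k, (n + m <= k)%N ->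
  pcoef (f * g) k = if k == (n + m)%N then pcoef f n * pcoef g m else 0.
Proof.
elim: n f => [|n IH] f df dg k.
  rewrite add0n {1}(degree_lt1 df) pcoefCM.
  by rewrite leq_eqVlt eq_sym; case: eqP => [->//|_ /= lt]; rewrite dg ?mulr0.
have [f'] := pX_quotient f; move: (pcoef f 0) => b fE; rewrite {f}fE in df *.
have df' : degree_lt n.+1 f'.
  by move=> i le; have := df i.+1 le; rewrite pcoefD pcoefXMS pcoefC addr0.
case: k => // k; rewrite addSn ltnS => le.
rewrite mulrDl pcoefD -mulrA pcoefXMS pcoefCM dg; last by lia.
by rewrite mulr0 addr0 IH // eqSS pcoefD pcoefXMS pcoefC addr0.
Qed.

Lemma polyalg_domain :
  GRing.integral_domain_axiom B -> GRing.integral_domain_axiom (polyalg B).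
Proof.
move=> dB f g fg0; apply/orP; case: (altP (f =P 0)) => [_|f0]; first by left.
case: (altP (g =P 0)) => [_|g0]; first by right.
have lc : lead_coef (f : {poly B}) * lead_coef (g : {poly B}) != 0.
  apply/eqP => /dB; rewrite !lead_coef_eq0.
  by case/orP=> /eqP e; [move/eqP: f0 | move/eqP: g0].
have := lead_coef_proper_mul lc.
rewrite (_ : (f : {poly B}) * (g : {poly B}) = 0) ?lead_coef0 //.
by move=> /esym/eqP; rewrite (negPf lc).
Qed.

(** Hilbert's basis theorem for the ascending chain condition. The ideal
    of the coefficients in degree [d] of the members of degree at most [d]
    of [I n] grows both with [n] and with [d]: along the diagonal it stops
    growing at some [N], which settles all the degrees above [N], and only
    finitely many chains remain. *)
Theorem hilbert_basis : noetherian B -> noetherian (polyalg B).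
Proof.
move=> nB I_ idI incI.
have leI n m : (n <= m)%N -> (I_ n `<=` I_ m)%classic.
  elim: m => [|m IH]; first by rewrite leqn0 => /eqP->.
  by rewrite leq_eqVlt => /predU1P[->//|/IH H f /H /incI].
pose L n d : set B :=
  [set b | exists f, [/\ I_ n f, degree_lt d.+1 f & pcoef f d = b]]%classic.
have idL n d : ideal (L n d).
  split.
  - exists 0; split; [exact: ideal0 | by move=> k _; rewrite pcoef0 | exact: pcoef0].
  - move=> a b [f [If df <-]] [g [Ig dg <-]]; exists (f + g).
    split; [exact: idealD | by move=> k lk; rewrite pcoefD df ?dg ?addr0 | exact: pcoefD].
  - move=> a b [f [If df <-]]; exists (pC a * f).
    split; [exact: idealMl | by move=> k lk; rewrite pcoefCM df ?mulr0 | exact: pcoefCM].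
have leL n m d e : (n <= m)%N -> (d <= e)%N -> (L n d `<=` L m e)%classic.
  move=> nm /subnK <-; elim: (e - d)%N => [|i IH] b Lb.
    by case: Lb => f [If df fb]; exists f; split=> //; apply: leI If.
  have [f [If df fb]] := IH b Lb; exists (pX * f).
  by split; [exact: idealMl | exact: degree_ltXS | rewrite addSn pcoefXMS].
have [|N NP] := nB (fun n => L n n) (fun n => idL n n).
  by move=> n; apply: leL.
have low : exists M, forall d n, (d < N)%N -> (M <= n)%N -> (L n d `<=` L M d)%classic.
  elim: (N) => [|p [M MP]]; first by exists 0.
  have [|M' M'P] := nB (fun n => L n p) (fun n => idL n p).
    by move=> n; apply: leL.
  exists (maxn M M') => d n.
  rewrite ltnS leq_eqVlt geq_max => /predU1P[->|dp] /andP[Mn M'n].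
    by rewrite M'P //; apply: leL; rewrite ?leq_maxr.
  by apply: subset_trans (MP d n dp Mn) _; apply: leL; rewrite ?leq_maxl.
have [M MP] := low; pose Q := maxn M N.
have allL n d : (Q <= n)%N -> (L n d `<=` L Q d)%classic.
  rewrite geq_max => /andP[Mn Nn]; case: (ltnP d N) => dN.
    by apply: subset_trans (MP d n dN Mn) _; apply: leL; rewrite ?leq_maxl.
  have : (L n d `<=` L (maxn n d) (maxn n d))%classic.
    by apply: leL; rewrite ?leq_maxl ?leq_maxr.
  move=> /subset_trans; apply; rewrite NP ?leq_max ?Nn //.
  by apply: leL; rewrite ?leq_maxr.
exists Q => n Qn; apply/seteqP; split; last exact: leI.
move=> f; have := @degree_lt_size f; move: (size _) => d.
elim: d f => [|d IH] f df If; first by rewrite (degree_lt0 df); apply: ideal0.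
have [g [Ig dg gf]] : L Q d (pcoef f d) by apply: (allL n d Qn); exists f.
rewrite -(subrK g f); apply: idealD => //; apply: IH; last first.
  by apply: idealB => //; apply: leI Ig.
move=> k; rewrite leq_eqVlt => /predU1P[<-|dk]; first by rewrite pcoefB gf subrr.
by rewrite pcoefB df ?dg ?subrr.
Qed.

End Coefficients.

(** * Equivariant Poisson primes in noetherian algebras *)

Section Ideals.
Variables (K : fieldType) (A : comAlgType K).
Implicit Types (I J P : set A).

Lemma ideal_product_sub I J P : ideal P ->
  (forall a b, I a -> J b -> P (a * b)) -> (ideal_product I J `<=` P)%classic.
Proof.
move=> idP IJ _ [s [sIJ ->]]; apply: subspace_sum_seq; first exact: ideal_subspace.
by move=> p /sIJ[]; apply: IJ.
Qed.

Lemma ideal_exp I a n m : ideal I -> (n <= m)%N -> I (a ^+ n) -> I (a ^+ m).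
Proof. by move=> idI /subnK <- Ia; rewrite exprD; apply: idealMl. Qed.

Lemma ideal_natl (charK0 : [pchar K] =i pred0) I n a :
  ideal I -> I (n.+1%:R * a) -> I a.
Proof.
move=> idI; rewrite mulr_natl -scaler_nat; apply: idealZr => //.
by rewrite pchar0_natf_neq0.
Qed.

Definition radical I : set A := fun a => exists n, I (a ^+ n).

Lemma radical_ideal I : ideal I -> ideal (radical I).
Proof.
move=> idI; split.
- by exists 1%N; rewrite expr1; apply: ideal0.
- move=> a b [n Ia] [m Ib]; exists (n + m)%N; rewrite exprDn.
  apply: subspace_sum; first exact: ideal_subspace.
  move=> [i /= lti] _; rewrite -mulr_natr; apply: ideal_mulr => //.
  case: (leqP m i) => mi; first by apply: idealMl => //; apply: ideal_exp Ib.
  by apply: ideal_mulr => //; apply: ideal_exp Ia => //; lia.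
- by move=> a b [n Ib]; exists n; rewrite exprMn; apply: idealMl.
Qed.

(** For [a] outside of [I] with [(I : a)] as large as possible, an element
    [s] that is nilpotent modulo [I] must satisfy [s a \in I]: otherwise
    some [s ^ k a] would be a last power outside of [I], and its annihilator
    would contain [s] besides [(I : a)]. *)
Lemma nil_annihilator I J : noetherian A -> ideal I -> ~ I 1 ->
  (forall s, J s -> radical I s) ->
  exists2 a, ~ I a & forall s, J s -> I (s * a).
Proof.
move=> nA idI I1 nilJ.
pose col a : set A := fun s => I (s * a).
have id_col a : ideal (col a).
  split; rewrite /col; first by rewrite mul0r; apply: ideal0.
    by move=> s t; rewrite mulrDl; apply: idealD.
  by move=> s t; rewrite -mulrA; apply: idealMl.
have [a Ia amax] : exists2 a, ~ I a & forall b, ~ I b ->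
    (col a `<=` col b)%classic -> (col b `<=` col a)%classic.
  apply: contrapT => nomax.
  have step (a : {a | ~ I a}) : exists b : {a | ~ I a},
      (col (sval a) `<=` col (sval b))%classic
      /\ ~ (col (sval b) `<=` col (sval a))%classic.
    apply: contrapT => nob; apply: nomax; exists (sval a); first exact: (proj2_sig a).
    move=> b Ib ab; apply: contrapT => nba; apply: nob.
    by exists (exist _ b Ib).
  have [next nextP] := choice step.
  have [|N NP] := nA (fun n => col (sval (iter n next (exist _ 1 I1))))
    (fun n => id_col _).
    by move=> n; have [] := nextP (iter n next (exist _ 1 I1)).
  have [_] := nextP (iter N next (exist _ 1 I1)); apply.
  by rewrite -iterS (NP N.+1).
exists a => // s /nilJ[n Isn]; apply: contrapT => Isa.
have out k : ~ I (s ^+ k * a).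
  elim: k => [|k IH]; first by rewrite mul1r.
  move=> Isk; apply: Isa; apply: (amax _ IH) => [t ta|].
    by rewrite /col mulrCA; apply: idealMl.
  by rewrite /col mulrA -exprS.
by apply: (out n); apply: ideal_mulr.
Qed.

End Ideals.

Section EquivariantPrimes.
Variables (K : fieldType) (charK0 : [pchar K] =i pred0).
Variables (A : comAlgType K) (G : groupType).
Variables (br : A -> A -> A) (act : G -> A -> A).
Hypotheses (brP : poisson_bracket br) (actP : poisson_action br act).
Implicit Types (I J P : set A).

Definition colon P J : set A := fun a => forall s, J s -> P (a * s).

Lemma colon_stable_poisson P J : stable_poisson_ideal br act P ->
  stable_poisson_ideal br act J -> stable_poisson_ideal br act (colon P J).
Proof.
move=> [[idP brPP] stP] [[idJ brJ] stJ]; split; first split; first split.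
- by move=> s _; rewrite mul0r; apply: ideal0.
- by move=> a b Ia Ib s Js; rewrite mulrDl; apply: idealD; auto.
- by move=> a b Ib s Js; rewrite -mulrA; apply: idealMl; auto.
- move=> b a Pa s Js.
  rewrite (_ : _ * s = br b (a * s) - a * br b s); last first.
    by rewrite (pbrMr brP); ring.
  by apply: idealB => //; [apply: brPP; apply: Pa | apply: Pa; apply: brJ].
- move=> g a Pa s Js.
  rewrite -[s](pact1 actP) -(mulgV g) (pactM actP) -(pact_mul actP).
  by apply: stP; apply: Pa; apply: stJ.
Qed.

(** If [a ^ m (d a) ^ k] lies in a [d]-stable ideal for the derivation
    [d = br b], differentiating once and multiplying by [d a] trades a factor
    [a] for two factors [d a]. *)
Lemma radical_poisson P : poisson_ideal br P -> poisson_ideal br (radical P).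
Proof.
move=> [idP brPP]; split; first exact: radical_ideal.
move=> b a [n Pa].
suff trade m k : P (a ^+ m * br b a ^+ k) -> P (br b a ^+ (k + m.*2)).
  by exists (0 + n.*2)%N; apply: trade; rewrite mulr1.
elim: m k => [|m IH] k Pmk; first by rewrite addn0 -[X in P X]mul1r.
rewrite doubleS -!addSnnS; apply: IH.
apply: (ideal_natl charK0 (n := m) idP).
have := brPP b _ Pmk; rewrite (pbrMr brP) !(pbrX brP) /=.
move=> /(idealMl idP (br b a)).
case: k Pmk => [|k] Pmk /= P1.
  by refine (eq_ind _ P P1 _ _); rewrite !exprS expr0; ring.
have P2 := idealMl idP (k.+1%:R * br b (br b a)) Pmk.
refine (eq_ind _ P (idealB idP P1 P2) _ _).
by rewrite !exprS; ring.
Qed.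

Lemma radical_stable P : stable act P -> stable act (radical P).
Proof.
by move=> stP g a [n Pa]; exists n; rewrite -(actX actP); apply: stP.
Qed.

Variable P : set A.
Hypotheses (nA : noetherian A) (primeP : equiv_poisson_prime br act P).

Lemma equiv_prime_proper : ~ P 1.
Proof.
case: primeP => [[[idP _] _] PT _] P1; apply: PT; apply/seteqP; split=> // a _.
by rewrite -[a]mulr1; apply: idealMl.
Qed.

(** The radical [N] of [P] is an equivariant Poisson ideal, and so is [(P : N)],
    which is not contained in [P] by [nil_annihilator]; their product is. *)
Lemma equiv_prime_radical s n : P (s ^+ n) -> P s.
Proof.
case: (primeP) => [[pP stP] _ prP]; have [idP _] := pP => Psn.
have sN : stable_poisson_ideal br act (radical P).
  by split; [exact: radical_poisson | exact: radical_stable].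
have [a Pa aN] := nil_annihilator nA idP equiv_prime_proper (fun _ => id).
have [||] := prP _ _ (colon_stable_poisson (conj pP stP) sN) sN.
- by apply: ideal_product_sub => // x y; apply.
- by move=> sub; case: Pa; apply: sub => t Nt; rewrite mulrC; apply: aN.
- by apply; exists n.
Qed.

(** As [P] is radical, [(P : x)] is a Poisson ideal: if [x f \in P] then
    [(x {g, f}) ^ 2] is a multiple of [x {g, x f} - {g, x} (x f)]. The ideal
    [(P : (P : x))], which contains [x], multiplies it into [P]. *)
Lemma equiv_prime_eigenvector x : eigenvector act x ->
  (forall f, P (x * f) -> P f) \/ P x.
Proof.
move=> [x0 [chi chiP]]; case: (primeP) => [[pP stP] _ prP]; have [idP brPP] := pP.
have chi0 := eigenvalue_neq0 actP x0 chiP.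
pose Q : set A := fun f => P (x * f).
have sQ : stable_poisson_ideal br act Q.
  rewrite /Q; split; first split; first split.
  - by rewrite mulr0; apply: ideal0.
  - by move=> f g; rewrite mulrDr; apply: idealD.
  - by move=> f g; rewrite mulrCA; apply: idealMl.
  - move=> g f Pxf; apply: (@equiv_prime_radical _ 2).
    rewrite (_ : _ ^+ 2 = br g f * (x * br g (x * f) - br g x * (x * f))).
      by apply: idealMl => //; apply: idealB => //; apply: idealMl => //; apply: brPP.
    by rewrite (pbrMr brP); ring.
  - move=> g f Pxf; apply: (idealZr idP (chi0 g)).
    by rewrite scalerAl -chiP -(pact_mul actP); apply: stP.
have [||] := prP _ _ (colon_stable_poisson (conj pP stP) sQ) sQ.
- by apply: ideal_product_sub => // a b; apply.
- by move=> sub; right; apply: sub => f.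
- by move=> sub; left.
Qed.

End EquivariantPrimes.

(** * The homogeneous elements of a Poisson-Cauchon extension *)

Section PoissonCauchon.
Variables (K : fieldType) (charK0 : [pchar K] =i pred0).
Variables (B : comAlgType K) (br : B -> B -> B) (sigma delta : B -> B).
Variable brR : polyalg B -> polyalg B -> polyalg B.
Variables (r : nat) (act : torus K r -> polyalg B -> polyalg B).
Hypothesis cauchonR : poisson_cauchon br sigma delta brR act.
Variables (h0 : 'rV[K]_r) (D : polyalg B -> polyalg B) (lambda : K).
Hypotheses (lieD : lie_action act h0 D).
Hypothesis D_const : forall b : B, D b%:P = (sigma b)%:P.
Hypotheses (lambda_neq0 : lambda != 0) (D_X : D 'X = lambda *: ('X : polyalg B)).
Implicit Types (f g w : polyalg B) (a b u : B) (k n m s : nat).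
Implicit Types (I J : set B) (P : set (polyalg B)).

Local Notation pX := (pX B).
Local Notation ract := (restricted_action act).

Let brP : poisson_bracket br := pore_base (pc_ore cauchonR).
Let brRP : poisson_bracket brR := pore_bracket (pc_ore cauchonR).
Let actP : poisson_action brR act := pc_action cauchonR.

Lemma delta_linear c a b : delta (c *: a + b) = c *: delta a + delta b.
Proof. by have [[lin _] _] := pore_delta (pc_ore cauchonR); apply: lin. Qed.

Lemma delta0 : delta 0 = 0.
Proof. exact: linear_at0 (proj1 (proj1 (pore_delta (pc_ore cauchonR)))). Qed.

Lemma deltaZ c a : delta (c *: a) = c *: delta a.
Proof. by have := delta_linear c a 0; rewrite delta0 !addr0. Qed.

Lemma sigma0 : sigma 0 = 0.
Proof. exact: linear_at0 (proj1 (proj1 (pore_sigma (pc_ore cauchonR)))). Qed.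

Lemma brR_const a b : brR (pC a) (pC b) = pC (br a b).
Proof. exact: (pore_ext (pc_ore cauchonR)). Qed.

Lemma brR_X_const b : brR pX (pC b) = pC (sigma b) * pX + pC (delta b).
Proof. exact: (pore_X (pc_ore cauchonR)). Qed.

Lemma D_pC b : D (pC b) = pC (sigma b). Proof. exact: D_const. Qed.
Lemma D_pX : D pX = lambda *: pX. Proof. exact: D_X. Qed.

Lemma D_mul f g : D (f * g) = D f * g + f * D g.
Proof. exact: (lie_mul charK0 actP (pc_rational cauchonR) lieD). Qed.

Lemma D_add f g : D (f + g) = D f + D g.
Proof. exact: (lie_add lieD). Qed.

Lemma D_bracket f g : D (brR f g) = brR (D f) g + brR f (D g).
Proof. exact: (lie_bracket charK0 actP (pc_rational cauchonR) lieD). Qed.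

Lemma pcoefD_lie f k :
  pcoef (D f) k = sigma (pcoef f k) + (k%:R * lambda) *: pcoef f k.
Proof.
elim/poly_ind_pX: f k => [|f b IH] k.
  by rewrite (lie0 lieD) !pcoef0 sigma0 scaler0 addr0.
rewrite D_add D_mul D_pX D_pC -scalerAl !pcoefD !pcoefC.
case: k => [|k] /=.
  by rewrite pcoefZ !pcoefXM0 mul0r scale0r scaler0 !add0r addr0.
by rewrite pcoefZ !pcoefXMS IH !addr0 -natr1 mulrDl mul1r scalerDl; ring.
Qed.

Lemma pcoef_brX f k : pcoef (brR pX f) k
  = (if k is k'.+1 then sigma (pcoef f k') else 0) + delta (pcoef f k).
Proof.
elim/poly_ind_pX: f k => [|f b IH] k.
  by case: k => [|k]; rewrite (pbr0r brRP) !pcoef0 ?sigma0 delta0 addr0.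
rewrite (pbrDr brRP) (pbrMr brRP) (pbr_alt brRP) mul0r add0r brR_X_const.
rewrite (mulrC (pC _)) !pcoefD.
case: k => [|k]; first by rewrite !pcoefXM0 !pcoefC /= !add0r.
rewrite !pcoefXMS IH !pcoefC !addr0 pcoefD pcoefC.
case: k => [|k] /=; first by rewrite pcoefXM0 !add0r addrC.
by rewrite pcoefXMS !addr0.
Qed.

Lemma pcoef_br_const a f k : pcoef (brR (pC a) f) k
  = br a (pcoef f k) - k%:R * (sigma a * pcoef f k)
    - k.+1%:R * (delta a * pcoef f k.+1).
Proof.
elim/poly_ind_pX: f k => [|f b IH] k.
  by rewrite (pbr0r brRP) !pcoef0 (pbr0r brP) !mulr0 !subr0.
rewrite (pbrDr brRP) (pbrMr brRP) brR_const (pbrC brRP _ pX) brR_X_const.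
rewrite (_ : - (pC (sigma a) * pX + pC (delta a)) * f
  = - (pX * (pC (sigma a) * f)) - pC (delta a) * f); last by ring.
rewrite !pcoefD !pcoefN pcoefCM !pcoefC.
case: k => [|k]; first by rewrite !pcoefXM0 pcoefXMS /= !add0r; ring.
by rewrite !pcoefXMS IH pcoefCM /= !addr0 -!natr1; ring.
Qed.

(** The top coefficient of a bracket: only [sigma] is seen, because [delta]
    lowers the degree in [X]. *)
Lemma pcoef_bracket_top n m f g : degree_lt n.+1 f -> degree_lt m.+1 g ->
  forall k, (n + m <= k)%N -> pcoef (brR f g) k =
  if k == (n + m)%N then
    br (pcoef f n) (pcoef g m) + n%:R * (pcoef f n * sigma (pcoef g m))
      - m%:R * (sigma (pcoef f n) * pcoef g m)
  else 0.
Proof.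
move=> + dg; elim: n f => [|n IH] f df k.
  rewrite add0n {1}(degree_lt1 df) pcoef_br_const leq_eqVlt => /predU1P[<-|mk].
    by rewrite eqxx (dg m.+1) //; ring.
  by rewrite gtn_eqF // !dg ?(leqW mk) // (pbr0r brP) !mulr0 !subr0.
have [f'] := pX_quotient f; move: (pcoef f 0) => a fE; rewrite {f}fE in df *.
have df' : degree_lt n.+1 f'.
  by move=> i le; have := df i.+1 le; rewrite pcoefD pcoefXMS pcoefC addr0.
have dXg : degree_lt m.+2 (brR pX g).
  by move=> [|i] // le; rewrite pcoef_brX !dg ?sigma0 ?delta0 ?addr0 // ltnW.
case: k => // k; rewrite addSn ltnS => le.
rewrite (pbrDl brRP) (pbrMl brRP) !pcoefD !pcoefXMS pcoef_br_const pcoefC.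
rewrite (dg k.+1) ?(dg k.+2); [|lia..].
rewrite (pbr0r brP) !mulr0 !subr0 !addr0 (mulrC _ f') IH // eqSS.
rewrite (pcoefM_top df' dXg) ?addnS //eqSS.
case: eqP => _; last by rewrite addr0.
by rewrite pcoef_brX (dg m.+1) // delta0 addr0 -natr1; ring.
Qed.

(** [D f - X^-1 {X, f}] is a derivation of the localization at [X]. It kills a
    copy of [B], the image of the Cauchon map, and multiplies [X] by [lambda].
    The elements that it multiplies by [n lambda] are thus the products of
    [X ^ n] with the Cauchon images of elements of [B]; clearing denominators
    turns this eigenvector equation into the following one. *)
Definition homogeneous n f : Prop :=
  pX * D f - brR pX f = n%:R * lambda%:A * (pX * f).

Let lamE n f : n%:R * lambda%:A * f = (n%:R * lambda) *: f.
Proof. by rewrite -mulrA mulr_algl mulr_natl -scalerA scaler_nat. Qed.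

Lemma homogeneous_subspace n : subspace (homogeneous n).
Proof.
rewrite /homogeneous; split.
  by rewrite (lie0 lieD) (pbr0r brRP) !mulr0 subr0.
move=> c f g; rewrite !lamE => hf hg.
rewrite D_add (lieZ lieD) (pbrDr brRP) (pbrZr brRP) !mulrDr -!scalerAr scalerDr.
by rewrite scalerA (mulrC _ c) -(scalerA c) -hf -hg scalerBr; ring.
Qed.

Lemma homogeneous_brX n f : homogeneous n f ->
  brR pX f = pX * (D f - n%:R * lambda%:A * f).
Proof.
by move=> hf; rewrite mulrBr -[brR _ _](subKr (pX * D f)) hf; ring.
Qed.

Lemma homogeneousM n m f g :
  homogeneous n f -> homogeneous m g -> homogeneous (n + m) (f * g).
Proof.
move=> hf hg; rewrite /homogeneous D_mul (pbrMr brRP).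
by rewrite (homogeneous_brX hf) (homogeneous_brX hg) natrD; ring.
Qed.

(** The compatibility of [D] with the bracket makes the grading one of Poisson
    algebras. *)
Lemma homogeneous_bracket n m f g :
  homogeneous n f -> homogeneous m g -> homogeneous (n + m) (brR f g).
Proof.
move=> hf hg; rewrite /homogeneous D_bracket (pbr_leibniz brRP).
rewrite (homogeneous_brX hf) (homogeneous_brX hg).
rewrite (pbrMl brRP) (pbrMr brRP) (pbrDl brRP) (pbrDr brRP).
rewrite (pbrNl brRP) (pbrNr brRP) !lamE (pbrZl brRP) (pbrZr brRP) -!lamE.
rewrite (pbrC brRP f pX) (homogeneous_brX hf) (homogeneous_brX hg).
by rewrite natrD; ring.
Qed.

Lemma homogeneous_X : homogeneous 1 pX.
Proof. by rewrite /homogeneous D_pX (pbr_alt brRP) subr0 lamE mul1r scalerAr. Qed.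

Lemma homogeneous_1 : homogeneous 0 1.
Proof.
rewrite /homogeneous -pC1 D_pC brR_X_const.
rewrite (derivation_at1 (proj1 (pore_sigma (pc_ore cauchonR)))).
rewrite (derivation_at1 (proj1 (pore_delta (pc_ore cauchonR)))).
by rewrite pC0; ring.
Qed.

Lemma homogeneous_Xn n : homogeneous n (pX ^+ n).
Proof.
elim: n => [|n IH]; first exact: homogeneous_1.
by rewrite exprS -add1n; apply: homogeneousM => //; apply: homogeneous_X.
Qed.

Lemma homogeneous_XnM m n f : homogeneous n f -> homogeneous (m + n) (pX ^+ m * f).
Proof. exact/homogeneousM/homogeneous_Xn. Qed.

Lemma act_pX : exists2 chi : torus K r -> K,
  (forall h, chi h != 0) & forall h, act h pX = chi h *: pX.
Proof.
have [X0 [chi chiE]] := pc_eigen cauchonR.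
by exists chi => //; apply: (eigenvalue_neq0 actP X0 chiE).
Qed.

Lemma homogeneous_act n : stable act (homogeneous n).
Proof.
move=> h f hf; have [chi chi0 chiE] := act_pX.
apply: (scalerI (chi0 h)).
have /(congr1 (act h)) := hf; rewrite !lamE -scaleN1r (actD actP) !(actZ actP).
rewrite !(pact_mul actP) (pact_br actP) chiE (pbrZl brRP) -!scalerAl.
rewrite -(lie_act charK0 actP (pc_rational cauchonR) lieD) scaleN1r -scalerBr => ->.
by rewrite !scalerA mulrC.
Qed.

Lemma homogeneous_coef n f : homogeneous n f <-> (delta (pcoef f 0) = 0 /\
  forall k, delta (pcoef f k.+1) = ((k%:R - n%:R) * lambda) *: pcoef f k).
Proof.
rewrite /homogeneous lamE; split=> [e|[e0 eS]].
  split=> [|k].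
    have /(congr1 (fun g => pcoef g 0)) := e.
    rewrite pcoefB pcoefZ !pcoefXM0 scaler0 sub0r pcoef_brX add0r => /eqP.
    by rewrite oppr_eq0 => /eqP.
  have /(congr1 (fun g => pcoef g k.+1)) := e.
  rewrite pcoefB pcoefZ !pcoefXMS pcoefD_lie pcoef_brX.
  rewrite mulrBl scalerBl => <-; ring.
apply: pcoefP => -[|k].
  by rewrite pcoefB pcoefZ !pcoefXM0 scaler0 sub0r pcoef_brX add0r e0 oppr0.
rewrite pcoefB pcoefZ !pcoefXMS pcoefD_lie pcoef_brX eS.
by rewrite mulrBl scalerBl; ring.
Qed.

(** At the leading coefficient, in degree [d], the equation reads
    [(d - n) lambda = 0]. *)
Lemma homogeneous_size n f : homogeneous n f -> f != 0 ->
  size (f : {poly B}) = n.+1.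
Proof.
move=> /homogeneous_coef[_ eS] f0.
have sf : (0 < size (f : {poly B}))%N by rewrite lt0n size_poly_eq0.
have := eS (size (f : {poly B})).-1.
rewrite prednK // [pcoef f (size _)]nth_default // delta0 => /esym/eqP.
rewrite scaler_eq0 mulf_eq0 (negPf lambda_neq0) orbF.
rewrite -[pcoef _ _]/(lead_coef (f : {poly B})).
rewrite lead_coef_eq0 (negPf (f0 : (f : {poly B}) != 0)) orbF subr_eq0 => /eqP.
by move=> /(pchar0_natf_inj charK0) <-; rewrite prednK.
Qed.

Lemma homogeneous_degree n f : homogeneous n f -> degree_lt n.+1 f.
Proof.
move=> hf; have [->|f0] := altP (f =P 0); first by move=> k _; rewrite pcoef0.
by rewrite -(homogeneous_size hf f0); apply: degree_lt_size.
Qed.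

Lemma homogeneous_leadM n m f g : homogeneous n f -> homogeneous m g ->
  pcoef (f * g) (n + m) = pcoef f n * pcoef g m.
Proof.
move=> /homogeneous_degree df /homogeneous_degree dg.
by rewrite (pcoefM_top df dg) // eqxx.
Qed.

Lemma homogeneous_lead_bracket n m f g : homogeneous n f -> homogeneous m g ->
  pcoef (brR f g) (n + m) = br (pcoef f n) (pcoef g m)
    + n%:R * (pcoef f n * sigma (pcoef g m))
    - m%:R * (sigma (pcoef f n) * pcoef g m).
Proof.
move=> /homogeneous_degree df /homogeneous_degree dg.
by rewrite (pcoef_bracket_top df dg) // eqxx.
Qed.

Lemma homogeneous_lead_eq0 n f : homogeneous n f -> pcoef f n = 0 -> f = 0.
Proof.
move=> hf fn; apply/eqP; apply: contrapT => /negP f0.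
have sf := homogeneous_size hf f0; move/eqP: (f0); apply.
apply/eqP; rewrite -[_ == _]/((f : {poly B}) == 0) -lead_coef_eq0.
by rewrite /lead_coef sf; apply/eqP.
Qed.

Lemma homogeneous_inj n f g : homogeneous n f -> homogeneous n g ->
  pcoef f n = pcoef g n -> f = g.
Proof.
move=> hf hg e; apply/eqP; rewrite -subr_eq0; apply/eqP.
apply: (@homogeneous_lead_eq0 n); last by rewrite pcoefB e subrr.
by rewrite -scaleN1r addrC; have [_] := homogeneous_subspace n; apply.
Qed.

(** The equation computes the lower coefficients from the top one, giving the
    truncated exponential of the Cauchon map; below the constant coefficient it
    leaves the condition that [delta ^ (m + 1)] kills [b]. *)
Lemma homogeneous_lift m b : iter m.+1 delta b = 0 ->
  exists f, [/\ homogeneous m f, pcoef f m = b &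
    exists c : nat -> K, (forall j, c j != 0) /\
      forall k, (k <= m)%N -> pcoef f k = c (m - k)%N *: iter (m - k) delta b].
Proof.
move=> dm; pose c j : K := ((- lambda) ^+ j * j`!%:R)^-1.
have c0 j : c j != 0.
  rewrite invr_eq0 mulf_neq0 ?expf_neq0 ?oppr_eq0 //.
  by rewrite pchar0_natf_neq0 // -lt0n fact_gt0.
have cS j : - (j.+1%:R * lambda) * c j.+1 = c j.
  rewrite /c exprS factS natrM [(_ * (j.+1%:R * _))]mulrACA invfM mulrA.
  rewrite (_ : - _ = - lambda * j.+1%:R); last by ring.
  by rewrite divff ?mul1r // mulf_neq0 ?oppr_eq0 ?pchar0_natf_neq0.
pose f : polyalg B := \poly_(k < m.+1) (c (m - k)%N *: iter (m - k) delta b).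
have fE k : (k <= m)%N -> pcoef f k = c (m - k)%N *: iter (m - k) delta b.
  by move=> km; rewrite /pcoef coef_poly ltnS km.
have f0 k : (m < k)%N -> pcoef f k = 0.
  by move=> km; rewrite /pcoef coef_poly ltnS leqNgt km.
exists f; split; last by exists c.
  apply/homogeneous_coef; split.
    by rewrite fE // subn0 deltaZ -iterS dm scaler0.
  move=> k; case: (ltngtP k m) => km.
  - rewrite !fE ?(ltnW km) // deltaZ -iterS subnSK // scalerA; congr (_ *: _).
    rewrite -[(m - k)%N](subnSK km) -cS; congr (_ * _).
    by rewrite subnSK // natrB ?(ltnW km) //; ring.
  - by rewrite !f0 ?delta0 ?scaler0 // ltnW.
  - by rewrite km subrr mul0r scale0r f0 ?delta0.
rewrite fE // subnn /c expr0 mul1r fact0.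
by rewrite (_ : 1%:R^-1 = 1) ?scale1r // invr1.
Qed.

Lemma homogeneous_lift_exists b :
  exists m f, homogeneous m f /\ pcoef f m = b.
Proof.
have [m dm] := pc_nilpotent cauchonR b.
have [|f [hf fb _]] := @homogeneous_lift m b; first by rewrite iterS dm delta0.
by exists m, f.
Qed.

(** * Saturated graded ideals *)

(** The contraction to [R] of the extension [I [X, X^-1]] of [I], for [B]
    embedded into the localization by the Cauchon map. *)
Inductive extension I : polyalg B -> Prop :=
| ExtHomogeneous n w of homogeneous n w & I (pcoef w n) : extension I w
| ExtAdd f g of extension I f & extension I g : extension I (f + g)
| ExtSaturated f of extension I (pX * f) : extension I f.

Lemma extension_X I f : extension I f -> extension I (pX * f).
Proof.
elim=> {f} [n w hw Iw|f g _ Ef _ Eg|f _ Ef].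
- apply: (@ExtHomogeneous _ n.+1); last by rewrite pcoefXMS.
  by rewrite -add1n; apply: homogeneousM => //; apply: homogeneous_X.
- by rewrite mulrDr; apply: ExtAdd.
- exact: ExtSaturated.
Qed.

Lemma extension_Xn I n f : extension I (pX ^+ n * f) <-> extension I f.
Proof.
elim: n f => [|n IH] f; first by rewrite mul1r.
by rewrite exprSr -mulrA IH; split; [apply: ExtSaturated | apply: extension_X].
Qed.

Lemma extensionM I J (Q : set B) f g :
  (forall a b, I a -> J b -> Q (a * b)) ->
  extension I f -> extension J g -> extension Q (f * g).
Proof.
move=> IJ Ef; elim: Ef g => {f} [n w hw Iw|f f' _ IHf _ IHf'|f _ IH] g Eg.
- elim: Eg => {g} [m v hv Jv|g g' _ IHg _ IHg'|g _ IHg].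
  + apply: (ExtHomogeneous (homogeneousM hw hv)).
    by rewrite homogeneous_leadM //; apply: IJ.
  + by rewrite mulrDr; apply: ExtAdd.
  + by apply: ExtSaturated; rewrite mulrCA.
- by rewrite mulrDl; apply: ExtAdd; auto.
- by apply: ExtSaturated; rewrite mulrA; apply: IH.
Qed.

Lemma poly_expand n f : degree_lt n f ->
  f = \sum_(k < n) pX ^+ k * pC (pcoef f k).
Proof.
elim: n f => [|n IH] f df; first by rewrite big_ord0; apply: degree_lt0.
have [f'] := pX_quotient f; move: (pcoef f 0) => a fE; rewrite {f}fE in df *.
rewrite big_ord_recl mul1r pcoefD pcoefXM0 add0r pcoefC [RHS]addrC; congr (_ + _).
rewrite {1}(IH f'); last first.
  by move=> i le; have := df i.+1 le; rewrite pcoefD pcoefXMS pcoefC addr0.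
rewrite mulr_sumr; apply: eq_bigr => k _.
by rewrite pcoefD pcoefXMS pcoefC addr0 exprS mulrA.
Qed.

(** [X] generates the localization over the Cauchon copy of [B]. By induction
    on the nilpotency index of [b] under [delta]: the lift of [b] is [b X ^ m]
    up to lower terms whose coefficients have a smaller index. *)
Lemma extension_setT f : extension setT f.
Proof.
have ext0 : extension setT 0 by apply: (ExtHomogeneous (proj1 (homogeneous_subspace 0))).
have extC m b : iter m.+1 delta b = 0 -> extension setT (pC b).
  elim/ltn_ind: m b => m IH b dm.
  have [w [hw wm [c [_ wE]]]] := homogeneous_lift dm.
  apply/(extension_Xn _ m); have := poly_expand (homogeneous_degree hw).
  rewrite big_ord_recr /= wm => /(canLR (addKr _)) <-.
  apply: ExtAdd; last exact: (ExtHomogeneous hw).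
  rewrite -sumrN; apply: (big_ind (extension setT)) => //; first exact: ExtAdd.
  move=> k _; rewrite -mulrN wE ?(ltnW (ltn_ord k)) // -scaleN1r -!pCZ.
  apply/extension_Xn; apply: (IH k) => //.
  suff itZ j d x : iter j delta (d *: x) = d *: iter j delta x.
    rewrite !itZ -iterD addSn subnKC ?(ltnW (ltn_ord k)) //.
    by rewrite dm !scaler0.
  by elim: j => //= j ->; rewrite deltaZ.
elim/poly_ind_pX: f => [//|f b Ef]; apply: ExtAdd; first exact: extension_X.
have [m dm] := pc_nilpotent cauchonR b.
by apply: (extC m); rewrite iterS dm delta0.
Qed.

Lemma extension_ideal I : ideal I -> ideal (extension I).
Proof.
move=> idI; split; last 2 first.
- by move=> f g; apply: ExtAdd.
- move=> f g Eg; apply: (@extensionM setT I I) => //; last exact: extension_setT.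
  by move=> a b _; apply: idealMl.
- apply: (ExtHomogeneous (proj1 (homogeneous_subspace 0))).
  by rewrite pcoef0; apply: ideal0.
Qed.

Lemma act_pC h b : act h (pC b) = pC (ract h b).
Proof.
have [c _ cE] : base_subalgebra (act h (pC b)).
  by apply: (pc_stable cauchonR); exists b.
by rewrite /ract /restricted_action -[b%:P]/(pC b) -cE /= coefC.
Qed.

Lemma pcoef_act (chi : torus K r -> K) h f k :
  (forall h, act h pX = chi h *: pX) ->
  pcoef (act h f) k = chi h ^+ k *: ract h (pcoef f k).
Proof.
move=> chiE; have ract0 : ract h 0 = 0.
  by rewrite /ract /restricted_action polyC0 (act0 actP) coef0.
have ractD a b : ract h (a + b) = ract h a + ract h b.
  by rewrite /ract /restricted_action polyCD (actD actP) coefD.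
elim/poly_ind_pX: f k => [|f b IH] k.
  by rewrite (act0 actP) !pcoef0 ract0 scaler0.
rewrite (actD actP) (pact_mul actP) chiE act_pC -scalerAl !pcoefD pcoefZ !pcoefC.
case: k => [|k]; first by rewrite !pcoefXM0 scaler0 !add0r scale1r.
by rewrite !pcoefXMS IH !addr0 scalerA -exprS.
Qed.

(** [sigma] is the restriction to [B] of the differential [D], which preserves
    the stable subspaces of [R]. *)
Lemma stable_ideal_sigma I : ideal I -> stable ract I ->
  forall a, I a -> I (sigma a).
Proof.
move=> idI stI a Ia; pose S : set (polyalg B) := fun f => exists2 b, I b & f = pC b.
have [|||b Ib] :=
  @lie_stable _ charK0 _ _ _ _ actP (pc_rational cauchonR) _ _ lieD S (pC a).
- split; first by exists 0; [exact: ideal0 | rewrite pC0].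
  move=> c _ _ [x Ix ->] [y Iy ->]; exists (c *: x + y); last by rewrite pCD pCZ.
  by apply: idealD => //; apply: idealZ.
- by move=> h _ [x Ix ->]; exists (ract h x); rewrite ?act_pC //; apply: stI.
- by exists a.
- rewrite D_pC => /(congr1 (fun f => pcoef f 0)); rewrite !pcoefC /= => ->.
  exact: Ib.
Qed.

Lemma extension_stable_poisson I : stable_poisson_ideal br ract I ->
  stable_poisson_ideal brR act (extension I).
Proof.
move=> [[idI brI] stI]; have idE := extension_ideal idI.
have sI := stable_ideal_sigma idI stI.
split; last first.
  move=> h f; have [chi chi0 chiE] := act_pX.
  elim=> {f} [n w hw Iw|f g _ Ef _ Eg|f _ Ef].
  - apply: (ExtHomogeneous (homogeneous_act h hw)).
    by rewrite (pcoef_act _ _ _ chiE); apply: idealZ => //; apply: stI.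
  - by rewrite (actD actP); apply: ExtAdd.
  - apply: ExtSaturated; apply: (idealZr idE (chi0 h)).
    by rewrite scalerAl -chiE -(pact_mul actP).
split=> // g f Ef; elim: Ef g => {f} [n w hw Iw|f f' _ IHf _ IHf'|f Ef IH] g.
- have hom m v : homogeneous m v -> extension I (brR v w).
    move=> hv; apply: (ExtHomogeneous (homogeneous_bracket hv hw)).
    rewrite homogeneous_lead_bracket //.
    apply: idealB; [by [] | apply: idealD; [by [] | exact: brI |] |].
      by do 2!apply: idealMl => //; apply: sI.
    by do 2!apply: idealMl => //.
  elim: (extension_setT g) => {g} [m v hv _|g g' _ IHg _ IHg'|g _ IHg].
  + exact: hom hv.
  + by rewrite (pbrDl brRP); apply: ExtAdd.
  + apply: ExtSaturated.
    rewrite (_ : pX * _ = brR (pX * g) w - brR pX w * g).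
      by apply: idealB => //; apply: ideal_mulr => //; apply: hom homogeneous_X.
    by rewrite (pbrMl brRP); ring.
- by rewrite (pbrDr brRP); apply: ExtAdd.
- apply: ExtSaturated; rewrite (_ : pX * _ = brR g (pX * f) - brR g pX * f).
    by apply: idealB => //; apply: idealMl => //; apply: ExtSaturated.
  by rewrite (pbrMr brRP); ring.
Qed.

(** The auxiliary variable keeps the homogeneous components apart, so that
    decompositions are multiplied as polynomials. *)
Lemma homogeneous_components f : exists k (p : {poly (polyalg B)}),
  (forall i, homogeneous i p`_i) /\ pX ^+ k * f = p.[1].
Proof.
have shift l (p : {poly (polyalg B)}) : (forall i, homogeneous i p`_i) ->
    forall i, homogeneous i ('X^l * ((pX ^+ l)%:P * p))`_i.
  move=> hp i; rewrite coefXnM coefCM; case: ltnP => li.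
    by case: (homogeneous_subspace i).
  by rewrite -{1}(subnKC li); apply: homogeneous_XnM.
have hornerE l (p : {poly (polyalg B)}) :
    ('X^l * ((pX ^+ l)%:P * p)).[1] = pX ^+ l * p.[1].
  by rewrite !hornerM hornerXn hornerC expr1n mul1r.
elim: (extension_setT f) => {f}
  [n w hw _|f g _ [k [p [hp pE]]] _ [l [q [hq qE]]]|f _ [k [p [hp pE]]]].
- exists 0%N, (w%:P * 'X^n); split; last first.
    by rewrite hornerM hornerC hornerXn expr1n mulr1 mul1r.
  move=> i; rewrite coefCM coefXn; case: eqP => [->|_]; first by rewrite mulr1.
  by rewrite mulr0; case: (homogeneous_subspace i).
- exists (k + l)%N, ('X^l * ((pX ^+ l)%:P * p) + 'X^k * ((pX ^+ k)%:P * q)); split.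
    move=> i; rewrite coefD; apply: subspaceD; first exact: homogeneous_subspace.
      exact: shift.
    exact: shift.
  by rewrite hornerD !hornerE -pE -qE exprD; ring.
- by exists k.+1, p; rewrite exprSr -mulrA.
Qed.

Definition saturated P := forall f, P (pX * f) -> P f.

Lemma saturated_Xn P n f : saturated P -> P (pX ^+ n * f) -> P f.
Proof. by move=> satP; elim: n => [|n IH]; rewrite ?mul1r // exprS -mulrA => /satP. Qed.

Lemma saturated_extension P I : ideal P -> saturated P ->
  (forall n w, homogeneous n w -> I (pcoef w n) -> P w) ->
  forall f, extension I f -> P f.
Proof.
move=> idP satP PI f; elim=> {f} [n w hw Iw|f g _ Pf _ Pg|f _ Pf].
- exact: PI Iw.
- exact: idealD.
- exact: satP.
Qed.

(** A saturated [P] is invariant under [f |-> D f - X^-1 {X, f}], whose distinct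
    eigenvalues [i lambda] on the components [separating_weights] separates. *)
Lemma saturated_graded P (p : {poly (polyalg B)}) :
  stable_poisson_ideal brR act P -> saturated P ->
  (forall i, homogeneous i p`_i) -> P p.[1] -> forall i, P p`_i.
Proof.
move=> [[idP brPP] stP] satP hp Pp i.
case: (ltnP i (size p)) => isz; last by rewrite nth_default //; apply: ideal0.
have [||||c Pc cE] := @separating_weights K unit _ (fun _ k => k%:R * lambda)
  (fun c => P (\sum_(k < size p) c k *: p`_k)) i (iota 0 (size p)).
- by move=> k /(_ tt)/(mulIf lambda_neq0)/(pchar0_natf_inj charK0).
- move: Pp; rewrite horner_coef; congr P; apply: eq_bigr => k _.
  by rewrite expr1n mulr1 scale1r.
- move=> c d a b Pa Pb; under eq_bigr do rewrite scalerDl -!scalerA.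
  by rewrite big_split /= -!scaler_sumr; apply: idealD => //; apply: idealZ.
- move=> _ c Pc; apply: satP.
  have PD := lie_stable charK0 actP (pc_rational cauchonR) lieD
    (ideal_subspace idP) stP Pc.
  have := idealB idP (idealMl idP pX PD) (brPP pX _ Pc).
  rewrite (lie_sum lieD).
  rewrite (big_morph (brR pX) (fun x y => pbrDr brRP x y pX) (pbr0r brRP pX)).
  rewrite !mulr_sumr -sumrB; congr P; apply: eq_bigr => k _.
  rewrite (lieZ lieD) (pbrZr brRP) -!scalerAr -scalerBr (hp k) lamE.
  by rewrite !scalerA mulrC.
move: Pc; rewrite (bigD1 (Ordinal isz)) //= cE ?mem_head // eqxx scale1r big1 ?addr0 //.
move=> k; rewrite -val_eqE /= => /negPf ki.
by rewrite cE ?ki ?scale0r // inE mem_iota leq0n add0n ltn_ord orbT.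
Qed.

(** * Lifting Poisson-prime eigenvectors *)

Hypothesis domB : GRing.integral_domain_axiom B.
Hypothesis ractP : poisson_action br ract.

Section LiftPrime.
Variables (u : B) (s : nat) (q : polyalg B).
Hypotheses (primeu : poisson_prime_element br u) (eigenu : eigenvector ract u).
Hypotheses (hq : homogeneous s q) (qs : pcoef q s = u) (q0 : pcoef q 0 <> 0).

Let u_neq0 : u != 0. Proof. by case: primeu. Qed.

Let stable_u : stable ract (principal_ideal u).
Proof.
have [_ [chi chiE]] := eigenu; move=> h _ [a _ <-].
by exists (chi h *: ract h a) => //; rewrite (pact_mul ractP) chiE -scalerAl scalerAr.
Qed.

(** [X] is a prime element of [R], as [B] is a domain, and it does not divide
    [q], whose constant coefficient is nonzero. *)
Lemma lift_saturated : saturated (principal_ideal q).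
Proof.
move=> f [g _ /esym gq]; have /esym := congr1 (fun f => pcoef f 0) gq.
rewrite pcoefXM0 pcoefM0 => /domB/orP[/eqP g0|/eqP //].
have [g'] := pX_quotient g; rewrite g0 pC0 addr0 => gE.
by exists g' => //; apply: pX_inj; rewrite gq gE mulrA.
Qed.

Lemma lift_dvd n w : homogeneous n w -> principal_ideal u (pcoef w n) ->
  principal_ideal q w.
Proof.
move=> hw [a _ aE]; have [m [v [hv vm]]] := homogeneous_lift_exists a.
apply: (saturated_Xn (n := m + s) lift_saturated).
exists (pX ^+ n * v) => //.
have hvq := homogeneousM hv hq; rewrite -mulrA.
apply: (homogeneous_inj (homogeneous_XnM n hvq)).
  by rewrite addnC; apply: homogeneous_XnM.
by rewrite pcoefXnM (addnC n) pcoefXnM homogeneous_leadM // vm qs.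
Qed.

Lemma lift_eigenvector : eigenvector act q.
Proof.
have [_ [psi psiE]] := eigenu; have [chi chi0 chiE] := act_pX.
split; first by apply/eqP => q_0; apply: q0; rewrite q_0 pcoef0.
exists (fun h => chi h ^+ s * psi h) => h.
apply: (homogeneous_inj (homogeneous_act h hq)).
  by have [h0' hS] := homogeneous_subspace s; rewrite -[_ *: q]addr0; apply: hS.
by rewrite (pcoef_act _ _ _ chiE) pcoefZ qs psiE scalerA.
Qed.

Lemma lift_bracket f : principal_ideal q (brR q f).
Proof.
have idq := principal_ideal_ideal q; have idu := principal_ideal_ideal u.
have uu : principal_ideal u u by exists 1; rewrite ?mul1r.
have hom n w : homogeneous n w -> principal_ideal q (brR q w).
  move=> hw; apply: (lift_dvd (homogeneous_bracket hq hw)).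
  rewrite homogeneous_lead_bracket // qs; apply: idealB => //.
    apply: idealD => //; first by case: primeu => _ /(_ (pcoef w n)).
    by apply: idealMl => //; apply: ideal_mulr.
  apply: idealMl => //; apply: ideal_mulr => //.
  exact: (stable_ideal_sigma idu stable_u).
elim: (extension_setT f) => {f} [n w hw _|f g _ qf _ qg|f _ qf].
- exact: hom hw.
- by rewrite (pbrDr brRP); apply: idealD.
- apply: lift_saturated; rewrite (_ : pX * _ = brR q (pX * f) - brR q pX * f).
    by apply: idealB => //; apply: ideal_mulr => //; apply: hom homogeneous_X.
  by rewrite (pbrMr brRP); ring.
Qed.

Lemma lift_stable_poisson : stable_poisson_ideal brR act (principal_ideal q).
Proof.
have idq := principal_ideal_ideal q; have [_ [chi chiE]] := lift_eigenvector.
split; first split=> //.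
  move=> f _ [g _ <-]; rewrite (pbrMr brRP); apply: idealD => //.
    by exists (brR f g).
  apply: idealMl => //; rewrite (pbrC brRP); apply: idealN => //.
  exact: lift_bracket.
move=> h _ [g _ <-]; rewrite (pact_mul actP) chiE -scalerAr.
by apply: idealZ => //; exists (act h g).
Qed.

(** Degrees add up since [B] is a domain, so the leading coefficient of a
    multiple of [q] is a multiple of [u]. *)
Lemma lift_lead n w : homogeneous n w -> principal_ideal q w ->
  principal_ideal u (pcoef w n).
Proof.
move=> hw [g _ gq]; have [g0|g0] := altP (g =P 0).
  by exists 0 => //; rewrite -gq g0 !mul0r pcoef0.
have sg : (0 < size (g : {poly B}))%N by rewrite lt0n size_poly_eq0.
have dg : degree_lt (size (g : {poly B})).-1.+1 g.
  by rewrite prednK //; apply: degree_lt_size.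
have := pcoefM_top dg (homogeneous_degree hq); rewrite qs gq.
have : pcoef g (size (g : {poly B})).-1 <> 0.
  by apply/eqP; rewrite -[pcoef _ _]/(lead_coef (g : {poly B})) lead_coef_eq0.
move: (_.-1) => d gd wE; exists (if n == (d + s)%N then pcoef g d else 0) => //.
case: (ltngtP n (d + s)) => c.
- have := wE _ (leqnn _); rewrite eqxx (homogeneous_degree hw) // => /esym/domB.
  by case/orP=> /eqP // u0; case/eqP: u_neq0.
- by rewrite wE ?(ltnW c) // gtn_eqF // mul0r.
- by rewrite c wE // eqxx.
Qed.

Lemma lift_homogeneous_prime n m w v : homogeneous n w -> homogeneous m v ->
  principal_ideal q (w * v) -> principal_ideal q w \/ principal_ideal q v.
Proof.
move=> hw hv /(lift_lead (homogeneousM hw hv)); have [_ _ [_ pru]] := primeu.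
by rewrite homogeneous_leadM // => /pru[/(lift_dvd hw)|/(lift_dvd hv)]; [left | right].
Qed.

(** The quotient is a domain on homogeneous elements because [B / (u)] is one,
    and then everywhere by looking at the lowest components outside of [(q)]. *)
Lemma lift_prime : poisson_prime_element brR q.
Proof.
have idq := principal_ideal_ideal q.
split; [by case: lift_eigenvector | exact: lift_bracket | split].
  move=> /(lift_lead homogeneous_1); rewrite -pC1 pcoefC /=.
  by case: primeu => _ _ [].
move=> f g qfg.
have [k [p [hp pE]]] := homogeneous_components f.
have [l [p' [hp' p'E]]] := homogeneous_components g.
have comp h j (pp : {poly (polyalg B)}) : pX ^+ j * h = pp.[1] ->
    ~ principal_ideal q h -> exists i, ~ principal_ideal q pp`_i.
  move=> ppE qh; apply: contrapT => allq; apply: qh.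
  apply: (saturated_Xn (n := j) lift_saturated); rewrite ppE horner_coef.
  apply: subspace_sum; first exact: ideal_subspace.
  move=> i _; apply: ideal_mulr => //; apply: contrapT => qi.
  by apply: allq; exists i.
apply: contrapT => /not_orP[qf qg].
have [i /asboolPn qi] := comp _ _ _ pE qf; have [j /asboolPn qj] := comp _ _ _ p'E qg.
have [i0 /asboolPn qi0 i0min] :=
  ex_minnP (ex_intro (fun e => ~~ `[< principal_ideal q p`_e >]) i qi).
have [j0 /asboolPn qj0 j0min] :=
  ex_minnP (ex_intro (fun e => ~~ `[< principal_ideal q p'`_e >]) j qj).
have below_i (e : nat) : (e < i0)%N -> principal_ideal q p`_e.
  by move=> lt; apply: contrapT => /asboolPn/i0min; rewrite leqNgt lt.
have below_j (e : nat) : (e < j0)%N -> principal_ideal q p'`_e.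
  by move=> lt; apply: contrapT => /asboolPn/j0min; rewrite leqNgt lt.
have hpp' (e : nat) : homogeneous e (p * p')`_e.
  rewrite coefM; apply: subspace_sum; first exact: homogeneous_subspace.
  by move=> [d /= lt] _; rewrite -{1}(subnKC (lt : (d <= e)%N)); apply: homogeneousM.
have qpp' : principal_ideal q (p * p').[1].
  rewrite hornerM -pE -p'E mulrACA; exact: idealMl.
have := saturated_graded lift_stable_poisson lift_saturated hpp' qpp' (i0 + j0).
have lt0 : (i0 < (i0 + j0).+1)%N by rewrite ltnS leq_addr.
rewrite coefM (bigD1 (Ordinal lt0)) //= addKn => qsum.
have [] // := lift_homogeneous_prime (hp i0) (hp' j0).
pose rest := \sum_(e < (i0 + j0).+1 | e != Ordinal lt0) p`_e * p'`_(i0 + j0 - e).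
rewrite -[_ * _](addrK rest).
apply: idealB => //; apply: subspace_sum; first exact: ideal_subspace.
move=> [e /= lte]; rewrite -val_eqE /=; case: ltngtP => // lt _.
  by apply: ideal_mulr => //; apply: below_i.
by apply: idealMl => //; apply: below_j; lia.
Qed.

End LiftPrime.

(** The least weight is taken in order that the constant coefficient, a multiple
    of the last nonzero [delta ^ s u], does not vanish. *)
Lemma lift_prime_eigenvector u :
  poisson_prime_element br u -> eigenvector ract u ->
  exists s q (c : K), [/\ homogeneous s q, pcoef q s = u,
    pcoef q 0 = c *: iter s delta u, poisson_prime_element brR q
    & eigenvector act q].
Proof.
move=> pu eu; have [u0 _ _] := pu.
have ex_s : exists s, iter s delta u == 0.
  by have [s /eqP] := pc_nilpotent cauchonR u; exists s.
case: (ex_minnP ex_s) => -[|s] /eqP us smin; first by case/eqP: u0.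
have [q [hq qs [c [c0 qE]]]] := homogeneous_lift us.
have q0E : pcoef q 0 = c s *: iter s delta u by rewrite qE // subn0.
have q0 : pcoef q 0 <> 0.
  apply/eqP; rewrite q0E scaler_eq0 (negPf (c0 s)) /=.
  by apply/negP => /smin; rewrite ltnn.
exists s, q, (c s); split=> //.
- exact: (lift_prime pu eu hq qs q0).
- exact: (lift_eigenvector eu hq qs q0).
Qed.

(** * Equivariant Poisson primes of the extension *)

Hypothesis ufdB : forall I, equiv_poisson_prime br ract I -> I <> [set 0]%classic ->
  exists c, [/\ I c, poisson_prime_element br c & eigenvector ract c].

Section PrimeIdeal.
Variable P : set (polyalg B).
Hypotheses (primeP : equiv_poisson_prime brR act P) (P_neq0 : P <> [set 0]%classic).

Let stP : stable_poisson_ideal brR act P. Proof. by case: primeP. Qed.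
Let idP : ideal P. Proof. by case: stP => -[]. Qed.

Let notP1 : ~ P 1. Proof. exact: (equiv_prime_proper primeP). Qed.

(** The contraction of [P [X^-1]] to the Cauchon copy of [B]. *)
Definition lead_ideal : set B :=
  fun b => exists n w, [/\ homogeneous n w, pcoef w n = b & P w].

Lemma lead_ideal_homogeneous n w : saturated P ->
  homogeneous n w -> lead_ideal (pcoef w n) -> P w.
Proof.
move=> satP hw [m [v [hv vm Pv]]]; apply: (saturated_Xn (n := m) satP).
suff -> : pX ^+ m * w = pX ^+ n * v by apply: idealMl.
apply: (homogeneous_inj (homogeneous_XnM m hw)).
  by rewrite addnC; apply: homogeneous_XnM.
by rewrite pcoefXnM addnC pcoefXnM vm.
Qed.

Lemma lead_ideal_ideal : ideal lead_ideal.
Proof.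
split.
- exists 0%N, 0; split; [by case: (homogeneous_subspace 0)|exact: pcoef0|exact: ideal0].
- move=> _ _ [n [w [hw <- Pw]]] [m [v [hv <- Pv]]].
  exists (m + n)%N, (pX ^+ m * w + pX ^+ n * v); split.
  + apply: subspaceD; [exact: homogeneous_subspace | exact: homogeneous_XnM |].
    by rewrite addnC; apply: homogeneous_XnM.
  + by rewrite pcoefD pcoefXnM addnC pcoefXnM.
  + by apply: idealD => //; apply: idealMl.
- move=> a _ [n [w [hw <- Pw]]]; have [m [v [hv vm]]] := homogeneous_lift_exists a.
  exists (m + n)%N, (v * w); split; [exact: homogeneousM | | exact: idealMl].
  by rewrite homogeneous_leadM // vm.
Qed.

Lemma lead_ideal_stable_poisson : stable_poisson_ideal br ract lead_ideal.
Proof.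
have [[_ brP_P] st] := stP; have idL := lead_ideal_ideal.
have stL : stable ract lead_ideal.
  move=> h _ [n [w [hw <- Pw]]]; have [chi chi0 chiE] := act_pX.
  apply: (idealZr idL (expf_neq0 n (chi0 h))).
  exists n, (act h w); split; [exact: homogeneous_act | | exact: st].
  exact: pcoef_act.
split=> //; split=> // a b Lb; have sb := stable_ideal_sigma idL stL Lb.
have [n [w [hw wn Pw]]] := Lb; have [m [v [hv vm]]] := homogeneous_lift_exists a.
have : lead_ideal (pcoef (brR v w) (m + n)).
  exists (m + n)%N, (brR v w); split=> //; first exact: homogeneous_bracket.
  exact: brP_P.
rewrite homogeneous_lead_bracket // vm wn -addrA => Lab.
rewrite -[br a b](addrK (m%:R * (a * sigma b) - n%:R * (sigma a * b))).
by apply: idealB => //; apply: idealB => //; do 2!apply: idealMl => //.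
Qed.

(** Stable Poisson ideals of [B] extend to [R] compatibly with products, so that
    contraction preserves primality. *)
Lemma lead_ideal_prime : saturated P -> equiv_poisson_prime br ract lead_ideal.
Proof.
move=> satP; split; first exact: lead_ideal_stable_poisson.
  move=> LT; have : lead_ideal (pcoef (1 : polyalg B) 0) by rewrite LT.
  by move=> /(lead_ideal_homogeneous satP homogeneous_1).
move=> I J sI sJ IJ.
have [_ _ prP] := primeP.
have sub I' : (extension I' `<=` P)%classic -> (I' `<=` lead_ideal)%classic.
  move=> EP a Ia; have [m [v [hv vm]]] := homogeneous_lift_exists a.
  by exists m, v; split=> //; apply: EP; apply: (ExtHomogeneous hv); rewrite vm.
have [|/sub|/sub] := prP _ _ (extension_stable_poisson sI) (extension_stable_poisson sJ);
  [ | by left | by right].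
apply: ideal_product_sub => // f g Ef Eg.
apply: (@saturated_extension P lead_ideal) => //.
  by move=> n w; apply: lead_ideal_homogeneous.
apply: extensionM Ef Eg => a b Ia Jb; apply: IJ.
exists [:: (a, b)]; rewrite big_seq1; split=> // p.
by rewrite inE => /eqP ->.
Qed.

Lemma lead_ideal_neq0 : saturated P -> lead_ideal <> [set 0]%classic.
Proof.
move=> satP L0; apply: P_neq0; apply/seteqP; split=> [f Pf|_ ->]; last exact: ideal0.
have [k [p [hp pE]]] := homogeneous_components f.
have Pp : P p.[1] by rewrite -pE; apply: idealMl.
have Pi := saturated_graded stP satP hp Pp.
apply: (@pXn_inj _ _ k); rewrite pE mulr0 horner_coef big1 // => i _.
have : lead_ideal (pcoef p`_i i) by exists i, p`_i.
by rewrite L0 => /(homogeneous_lead_eq0 (hp i)) ->; rewrite mul0r.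
Qed.

Lemma saturated_prime_eigenvector : saturated P ->
  exists c, [/\ P c, poisson_prime_element brR c & eigenvector act c].
Proof.
move=> satP.
have [u [Lu pu eu]] := ufdB (lead_ideal_prime satP) (lead_ideal_neq0 satP).
have [s [q [_ [hq qs _ pq eq]]]] := lift_prime_eigenvector pu eu.
by exists q; split=> //; apply: (lead_ideal_homogeneous satP hq); rewrite qs.
Qed.

(** If [X \in P] then [P = I + R X] for the contraction [I] of [P] to [B], and
    [R / P] is [B / I] as an equivariant Poisson algebra. *)
Definition contraction : set B := fun b => P (pC b).

Lemma contraction_coef0 f : P pX -> P f <-> contraction (pcoef f 0).
Proof.
move=> PX; have [g fE] := pX_quotient f; rewrite {1}fE /contraction.
split=> [Pf|Pc]; last by apply: idealD => //; apply: ideal_mulr.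
by rewrite -[pC _](addKr (pX * g)) addrC; apply: idealB => //; apply: ideal_mulr.
Qed.

Lemma contraction_delta b : P pX -> contraction (delta b).
Proof.
move=> PX; have [pP _] := stP; have := poisson_ideal_bracket brRP (pC b) pP PX.
rewrite brR_X_const => PXb; rewrite /contraction.
rewrite -[pC _](addKr (pC (sigma b) * pX)) addrC.
by apply: idealB => //; apply: idealMl.
Qed.

Lemma contraction_stable_poisson : stable_poisson_ideal br ract contraction.
Proof.
have [[_ brP_P] st] := stP; rewrite /contraction; split; first split; first split.
- by rewrite pC0; apply: ideal0.
- by move=> a b; rewrite pCD; apply: idealD.
- by move=> a b; rewrite pCM; apply: idealMl.
- by move=> a b; rewrite -brR_const; apply: brP_P.
- by move=> h a Pa; rewrite -act_pC; apply: st.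
Qed.

Lemma contraction_prime : P pX -> equiv_poisson_prime br ract contraction.
Proof.
move=> PX; split; first exact: contraction_stable_poisson.
  by move=> CT; have : contraction 1 by rewrite CT.
have [[_ brP_P] st] := stP; have [[idC _] _] := contraction_stable_poisson.
have [_ _ prP] := primeP; move=> I J sI sJ IJ.
(* the inverse image of [I + contraction] under [R -> B / contraction] *)
pose E (I : set B) : set (polyalg B) := fun f => exists2 a, I a & P (f - pC a).
have sE I' : stable_poisson_ideal br ract I' -> stable_poisson_ideal brR act (E I').
  move=> [[idI brI] stI]; split; first split; first split.
  - by exists 0; [exact: ideal0 | rewrite pC0 subr0; apply: ideal0].
  - move=> f g [a Ia Pa] [b Ib Pb]; exists (a + b); first exact: idealD.
    rewrite pCD (_ : _ - _ = f - pC a + (g - pC b)); last by ring.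
    exact: idealD.
  - move=> f g [b Ib Pb]; exists (pcoef f 0 * b); first exact: idealMl.
    rewrite pCM (_ : _ - _ = f * (g - pC b) + (f - pC (pcoef f 0)) * pC b); last by ring.
    apply: idealD; [by [] | exact: idealMl | apply: ideal_mulr => //].
    by have [f' {1}->] := pX_quotient f; rewrite addrK; apply: ideal_mulr.
  - move=> f g [b Ib Pb]; exists (br (pcoef f 0) b); first exact: brI.
    have [f' fE] := pX_quotient f.
    rewrite (_ : _ - _ = brR f (g - pC b) + brR (pX * f') (pC b)).
      apply: idealD => //; first exact: brP_P.
      by apply: (poisson_ideal_bracket brRP); [case: stP | apply: ideal_mulr].
    have e : brR f (pC b) = brR (pX * f') (pC b) + pC (br (pcoef f 0) b).
      by rewrite {1}fE (pbrDl brRP) brR_const.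
    by rewrite (pbrDr brRP) (pbrNr brRP) e; ring.
  - move=> h f [a Ia Pa]; exists (ract h a); first exact: stI.
    have := st h _ Pa; rewrite -scaleN1r (actD actP) (actZ actP) scaleN1r.
    by rewrite act_pC.
have sub I' : (E I' `<=` P)%classic -> (I' `<=` contraction)%classic.
  by move=> EP a Ia; apply: EP; exists a => //; rewrite subrr; apply: ideal0.
have [|/sub|/sub] := prP _ _ (sE _ sI) (sE _ sJ); [ | by left | by right].
apply: ideal_product_sub => // f g [a Ia Pa] [b Jb Pb].
rewrite (_ : f * g = (f - pC a) * g + pC a * (g - pC b) + pC a * pC b); last by ring.
apply: idealD => //; first by apply: idealD => //; [apply: ideal_mulr | apply: idealMl].
rewrite -pCM; apply: IJ; exists [:: (a, b)]; rewrite big_seq1; split=> // p.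
by rewrite inE => /eqP ->.
Qed.

(** For [delta = 0] the brackets with [X] are multiples of [X]; and [R / (X)] is
    the domain [B]. *)
Lemma X_poisson_prime : (forall b, delta b = 0) -> poisson_prime_element brR pX.
Proof.
move=> d0; have XE f : principal_ideal pX f <-> pcoef f 0 = 0.
  split=> [[g _ <-]|f0]; first by rewrite mulrC pcoefXM0.
  have [g ->] := pX_quotient f; rewrite f0 pC0 addr0.
  by exists g; rewrite //= mulrC.
split; [exact: pX_neq0 | by move=> f; apply/XE; rewrite pcoef_brX d0 addr0 | split].
  by move=> /XE; rewrite -pC1 pcoefC /=; apply/eqP/oner_neq0.
by move=> f g /XE; rewrite pcoefM0 => /domB/orP[]/eqP e; [left | right]; apply/XE.
Qed.

Lemma X_in_prime_eigenvector : P pX ->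
  exists c, [/\ P c, poisson_prime_element brR c & eigenvector act c].
Proof.
move=> PX; have [d0|/existsNP[b db]] := EM (forall b, delta b = 0).
  by exists pX; split=> //; [exact: X_poisson_prime | exact: pc_eigen cauchonR].
have C0 : contraction <> [set 0]%classic.
  by move=> C0; have := contraction_delta b PX; rewrite C0.
have [u [Cu pu eu]] := ufdB (contraction_prime PX) C0.
have [[idC _] _] := contraction_stable_poisson.
have [s [q [c [hq qs q0 pq eq]]]] := lift_prime_eigenvector pu eu.
exists q; split=> //; apply/contraction_coef0 => //; rewrite q0; apply: idealZ => //.
by case: s {hq qs q0} => [|s] //=; apply: contraction_delta.
Qed.

End PrimeIdeal.

Lemma prime_eigenvector_in_prime P : noetherian B ->
  equiv_poisson_prime brR act P -> P <> [set 0]%classic ->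
  exists c, [/\ P c, poisson_prime_element brR c & eigenvector act c].
Proof.
move=> nB primeP P0.
have [satP|PX] := equiv_prime_eigenvector charK0 brRP actP (hilbert_basis nB)
  primeP (pc_eigen cauchonR).
- exact: saturated_prime_eigenvector.
- exact: X_in_prime_eigenvector.
Qed.

End PoissonCauchon.

Theorem theorem4p7 (K : fieldType) (charK0 : [pchar K] =i pred0)
    (B : comAlgType K) (br : B -> B -> B) (sigma delta : B -> B)
    (brR : polyalg B -> polyalg B -> polyalg B)
    (r : nat) (act : torus K r -> polyalg B -> polyalg B)
    (cauchonR : poisson_cauchon br sigma delta brR act)
    (noethB : noetherian B)
    (ufdB : equiv_poisson_ufd br (restricted_action act)) :
  noetherian (polyalg B) /\ equiv_poisson_ufd brR act.
Proof.
have [domB _ ractP primesB] := ufdB.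
have [h0 [D [lieD D_const [lambda lambda_neq0 D_X]]]] := pc_lie cauchonR.
split; first exact: hilbert_basis.
split; [exact: polyalg_domain | exact: pore_bracket (pc_ore cauchonR)
      | exact: pc_action cauchonR | move=> P primeP P0].
exact: (prime_eigenvector_in_prime charK0 cauchonR lieD D_const lambda_neq0 D_X
          domB ractP primesB).
Qed.
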